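(* (a) There is an algorithm that, given an automatic sequence $\mathbf{s}$ (specified by a regular numeration system and a finite automaton generating it) and a constant $c \in \mathbb{N}$, decides whether every prefix of $\mathbf{s}$ has a string attractor of size at most $c$. (b) Furthermore, if this is the case, one can construct a finite automaton that, for each $n$, provides the elements of a minimal string attractor for the length-$n$ prefix $\mathbf{s}[0..n-1]$ of $\mathbf{s}$.
   Context: Words are indexed starting at $0$; for a word $w$, $w[i..j]$ denotes the factor $w[i]w[i+1]\cdots w[j]$. A string attractor of a finite word $w=w[0..n-1]$ is a set $S\subseteq\{0,1,\ldots,n-1\}$ such that every nonempty factor $f$ of $w$ has an occurrence $w[p..q]=f$ with $p\le i\le q$ for some $i\in S$. A numeration system represents each natural number uniquely as a word over a finite alphabet; it is regular if the set of canonical representations is a regular language and the addition relation $z=x+y$ (on representations read in parallel, suitably padded) is recognizable by a finite automaton. Examples are base-$b$ representation ($b\ge 2$), Fibonacci, Tribonacci and Ostrowski numeration. A sequence $\mathbf{s}=(s_n)_{n\ge 0}$ over a finite alphabet is automatic if there is a regular numeration system and a finite automaton that, given the representation of $n$ as input, outputs $s_n$. *)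

(* Defs.v *)
From mathcomp Require Import all_boot.
Set Implicit Arguments. Unset Strict Implicit. Unset Printing Implicit Defensive.

(* Finite automata with output (DFAO).  States and letters are naturals;    *)
(* the transition table is stored as a finite list indexed by               *)
(* q * d_letters + a, the output table as a finite list indexed by states.  *)
(* Only finitely many states are reachable (entries of a finite list), so   *)
(* this is a genuine finite automaton.  A DFA (acceptor) is a DFAO whose    *)
(* nonzero outputs mean "accept".  Words are read most significant digit    *)
(* first (left to right).                                                   *)
Record dfao := DFAO {
  d_letters : nat;
  d_start : nat;
  d_trans : seq nat;
  d_out : seq nat }.

Definition dfao_state (A : dfao) (w : seq nat) : nat :=
  foldl (fun q a => nth 0 (d_trans A) (q * d_letters A + a)) (d_start A) w.

Definition dfao_output (A : dfao) (w : seq nat) : nat :=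
  nth 0 (d_out A) (dfao_state A w).

Definition dfa_accepts (A : dfao) (w : seq nat) : bool := dfao_output A w != 0.

(* Reading several words in parallel: pad them on the left with the letter *)
(* 0 to the common (maximal) length and combine the letters of track j      *)
(* with weight b^j into a single letter over an alphabet of size b^k.       *)
Definition pad (l : nat) (w : seq nat) : seq nat := nseq (l - size w) 0 ++ w.

Definition tuple_word (b : nat) (ws : seq (seq nat)) : seq nat :=
  let l := \max_(w <- ws) size w in
  mkseq (fun t => \sum_(j < size ws) nth 0 (pad l (nth [::] ws j)) t * b ^ j) l.

Definition regular_numeration (b : nat) (rep : nat -> seq nat) (L Add : dfao)
  : Prop :=
  [/\ injective rep,
      forall n, all (fun a => a < b) (rep n),
      forall w, all (fun a => a < b) w -> (dfa_accepts L w <-> exists n, rep n = w)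
    & forall x y z,
        dfa_accepts Add (tuple_word b [:: rep x; rep y; rep z]) <-> z = x + y].

Definition auto_seq (S : dfao) (rep : nat -> seq nat) (n : nat) : nat :=
  dfao_output S (rep n).

Definition is_string_attractor (s : nat -> nat) (n : nat) (S : {set 'I_n}) : Prop :=
  forall p l, 0 < l -> p + l <= n ->
    exists p', [/\ p' + l <= n,
                   (forall k, k < l -> s (p' + k) = s (p + k))
                 & exists2 i : 'I_n, i \in S & p' <= i < p' + l].

Definition is_minimum_attractor (s : nat -> nat) (n : nat) (S : {set 'I_n}) : Prop :=
  is_string_attractor s S /\
  forall S' : {set 'I_n}, is_string_attractor s S' -> #|S| <= #|S'|.

Definition prefixes_have_attractor_of_size (s : nat -> nat) (c : nat) : Prop :=
  forall n, exists S : {set 'I_n}, is_string_attractor s S /\ #|S| <= c.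

Definition provides_min_attractors (b : nat) (rep : nat -> seq nat)
  (s : nat -> nat) (c : nat) (B : dfao) : Prop :=
  forall n, 0 < n ->
    (exists ps : seq nat, size ps = c /\
        dfa_accepts B (tuple_word b (map rep (n :: ps)))) /\
    (forall ps : seq nat, size ps = c ->
        dfa_accepts B (tuple_word b (map rep (n :: ps))) ->
        all (fun i => i < n) ps /\
        is_minimum_attractor s [set i : 'I_n | val i \in ps]).

(* Model of computation: counter (Minsky) machines, input and output in      *)
(* register 0.  Data are encoded as naturals via Cantor pairing.             *)
Inductive instr := Inc of nat | Dec of nat & nat.

Definition cm_step (p : seq instr) (cf : nat * seq nat) : nat * seq nat :=
  let: (pc, regs) := cf in
  if pc < size p then
    match nth (Inc 0) p pc with
    | Inc r => (pc.+1, set_nth 0 regs r (nth 0 regs r).+1)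
    | Dec r j =>
        if nth 0 regs r is k.+1 then (pc.+1, set_nth 0 regs r k) else (j, regs)
    end
  else cf.

Definition cm_halts_with (p : seq instr) (x y : nat) : Prop :=
  exists t, let cf := iter t (cm_step p) (0, [:: x]) in
            size p <= cf.1 /\ nth 0 cf.2 0 = y.

Definition pairn (x y : nat) : nat := (x + y) * (x + y).+1 %/ 2 + y.

Fixpoint code_seq (s : seq nat) : nat :=
  if s is x :: s' then (pairn x (code_seq s')).+1 else 0.

Definition code_dfao (A : dfao) : nat :=
  code_seq (d_letters A :: d_start A :: size (d_trans A) :: d_trans A ++ d_out A).

Definition code_input (b : nat) (L Add S : dfao) (c : nat) : nat :=
  code_seq [:: b; c; code_dfao L; code_dfao Add; code_dfao S].

(* Main.v *)
Require Import Defs.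
From mathcomp Require Import all_boot zify boolp.
Set Implicit Arguments. Unset Strict Implicit. Unset Printing Implicit Defensive.

(** The numeration system is turned into base-[b] arithmetic: [n] is coded by
    the number [ncode n] whose base-[b] digits are a leading 1 followed by [rep n].
    A relation on coded numbers is regular when it is saturated by a colouring
    [st] of assignments with finitely many colours such that the colour of
    [X * b + D] (all variables shifted by one digit) depends only on the colour
    of [X] and on the digits [D].  Quantifying a block of variables replaces
    the colours by sets of colours, and a pumping argument shows that witnesses
    need only as many additional digits as there are colours.  Hence the truth
    of "every prefix has an attractor with [c] positions", a first-order
    statement over addition and the sequence, is decided by evaluating all its
    quantifiers up to a computable bound, without building any automaton.

    For the second part one searches for an automaton agreeing with the formula
    "[i_1, ..., i_c] is a minimal attractor of the prefix of length [n]"; the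
    agreement is itself such a first-order statement, and an automaton passing
    the test exists by the subset construction on colours.

    Both procedures are written in a small primitive recursive language with a
    stack-like compilation to counter machines, below one unbounded search. *)

(** * Compiling primitive recursion to counter machines *)

(** De Bruijn terms; in the step of [Rec] variable 0 is the accumulator and variable 1 the round.
    [Del k n e] is weakening: [e] is read with [n] environment entries skipped from index [k] on, so
    an expression can be reused below further binders without renaming. *)
Inductive expr :=
  | Var of nat
  | Zero
  | Suc of expr
  | Let of expr & expr
  | Del of nat & nat & expr
  | Rec of expr & expr & expr.

Fixpoint eval (env : seq nat) (e : expr) : nat :=
  match e with
  | Var i => nth 0 env i
  | Zero => 0
  | Suc a => (eval env a).+1
  | Let a e => eval (eval env a :: env) e
  | Del k n e => eval (take k env ++ drop (k + n) env) e
  | Rec n a s =>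
      iteri (eval env n) (fun i acc => eval (acc :: i :: env) s) (eval env a)
  end.

Definition upd (f : nat -> nat) (r v : nat) : nat -> nat :=
  fun j => if j == r then v else f j.

(** Registers are described by a total function, compared through [nth 0], so that the length of the
    register list does not matter. *)
Definition steps (P : seq instr) pc (f : nat -> nat) pc' (f' : nat -> nat) :=
  forall regs, nth 0 regs =1 f -> exists t regs',
    iter t (cm_step P) (pc, regs) = (pc', regs') /\ nth 0 regs' =1 f'.

Definition code_at (P : seq instr) o (c : seq instr) :=
  forall i, i < size c ->
    o + i < size P /\ nth (Inc 0) P (o + i) = nth (Inc 0) c i.

Lemma code_at_cat P o c1 c2 : code_at P o (c1 ++ c2) ->
  code_at P o c1 /\ code_at P (o + size c1) c2.
Proof.
move=> H; split=> i Hi.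
  have [|h1 h2] := H i; first by rewrite size_cat; lia.
  by split=> //; rewrite h2 nth_cat Hi.
have [|h1 h2] := H (size c1 + i); first by rewrite size_cat; lia.
rewrite -addnA; split=> //; rewrite h2 nth_cat.
by rewrite ifN ?addKn //; lia.
Qed.

Lemma code_at_cons P o x c : code_at P o (x :: c) ->
  (o < size P /\ nth (Inc 0) P o = x) /\ code_at P o.+1 c.
Proof.
move=> H; split; first by have := H 0 isT; rewrite addn0.
by move=> i Hi; have := H i.+1 Hi; rewrite addnS addSn.
Qed.

Lemma steps_refl P pc f f' : f =1 f' -> steps P pc f pc f'.
Proof. by move=> E regs H; exists 0, regs; split=> // j; rewrite H E. Qed.

Lemma steps_trans P pc1 f1 pc2 f2 pc3 f3 :
  steps P pc1 f1 pc2 f2 -> steps P pc2 f2 pc3 f3 -> steps P pc1 f1 pc3 f3.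
Proof.
move=> H1 H2 regs /H1 [t1 [r1 [E1 /H2 [t2 [r2 [E2 H]]]]]].
by exists (t2 + t1), r2; rewrite iterD E1 E2.
Qed.

Lemma steps_ext P pc1 f1 pc2 f2 f3 :
  steps P pc1 f1 pc2 f2 -> f2 =1 f3 -> steps P pc1 f1 pc2 f3.
Proof. by move=> H E; apply: steps_trans H _; apply: steps_refl. Qed.

Lemma steps_eq P pc f pc1 pc2 f' :
  steps P pc f pc1 f' -> pc1 = pc2 -> steps P pc f pc2 f'.
Proof. by move=> H <-. Qed.

Lemma steps_inc P pc r f :
  pc < size P /\ nth (Inc 0) P pc = Inc r ->
  steps P pc f pc.+1 (upd f r (f r).+1).
Proof.
move=> [hs hn] regs H; exists 1, (set_nth 0 regs r (nth 0 regs r).+1).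
by rewrite /= hs hn; split=> // j; rewrite nth_set_nth /= /upd !H.
Qed.

Lemma steps_decS P pc r j f k :
  pc < size P /\ nth (Inc 0) P pc = Dec r j -> f r = k.+1 ->
  steps P pc f pc.+1 (upd f r k).
Proof.
move=> [hs hn] E regs H; exists 1, (set_nth 0 regs r k).
by rewrite /= hs hn H E; split=> // i; rewrite nth_set_nth /= /upd H.
Qed.

Lemma steps_dec0 P pc r j f :
  pc < size P /\ nth (Inc 0) P pc = Dec r j -> f r = 0 ->
  steps P pc f j f.
Proof. by move=> [hs hn] E regs H; exists 1, regs; rewrite /= hs hn H E. Qed.

(* Register 1 is kept at zero, so that [Dec 1 j] is an unconditional jump. *)
Definition clear o r := [:: Dec r (o + 2); Dec 1 o].
Definition move_reg o r s := [:: Dec r (o + 3); Inc s; Dec 1 o].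
Definition copy_reg o r s u :=
  [:: Dec r (o + 4); Inc s; Inc u; Dec 1 o] ++ move_reg (o + 4) u r.

Arguments clear : simpl never.
Arguments move_reg : simpl never.
Arguments copy_reg : simpl never.

Lemma size_clear o r : size (clear o r) = 2. Proof. by []. Qed.
Lemma size_move o r s : size (move_reg o r s) = 3. Proof. by []. Qed.
Lemma size_copy o r s u : size (copy_reg o r s u) = 7. Proof. by []. Qed.
Definition size_regs := (size_clear, size_move, size_copy).

Ltac upd_ext := let j := fresh "j" in
  move=> j; rewrite /upd ?eqxx;
  repeat match goal with
  | |- context [if ?a == ?b then _ else _] =>
      let E := fresh "E" in
      case: (eqVneq a b) => E; [try subst a; try subst b | idtac]
  end; rewrite ?eqxx //; try congruence; lia.

Lemma upd_neq f r v j : j != r -> upd f r v j = f j.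
Proof. by rewrite /upd => /negbTE ->. Qed.

Lemma upd_eq f r v : upd f r v r = v.
Proof. by rewrite /upd eqxx. Qed.

Lemma clear_ok P o r f : code_at P o (clear o r) -> f 1 = 0 -> r != 1 ->
  steps P o f (o + 2) (upd f r 0).
Proof.
move=> /code_at_cons [H1 /code_at_cons [H2 _]] f1 r1.
have [k Hk] : exists k, f r = k by exists (f r).
elim: k f f1 Hk => [|k IH] f f1 Hk.
  by apply: steps_trans (steps_dec0 H1 Hk) _; apply: steps_refl; upd_ext.
apply: steps_trans (steps_decS H1 Hk) _.
have g1 : upd f r k 1 = 0 by rewrite upd_neq // eq_sym.
apply: steps_trans (steps_dec0 H2 g1) _.
by apply: steps_ext (IH _ g1 (upd_eq _ _ _)) _; upd_ext.
Qed.

Lemma move_ok P o r s f : code_at P o (move_reg o r s) -> f 1 = 0 ->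
  r != s -> s != 1 -> r != 1 ->
  steps P o f (o + 3) (upd (upd f s (f s + f r)) r 0).
Proof.
move=> /code_at_cons [H1 /code_at_cons [H2 /code_at_cons [H3 _]]] f1 rs s1 r1.
have [k Hk] : exists k, f r = k by exists (f r).
elim: k f f1 Hk => [|k IH] f f1 Hk.
  by apply: steps_trans (steps_dec0 H1 Hk) _; apply: steps_refl; upd_ext.
apply: steps_trans (steps_decS H1 Hk) _.
apply: steps_trans (@steps_inc _ _ _ _ H2) _.
set g := upd _ _ _.
have g1 : g 1 = 0 by rewrite /g !upd_neq // eq_sym.
apply: steps_trans (steps_dec0 H3 g1) _.
have gr : g r = k by rewrite /g upd_neq // upd_eq.
by apply: steps_ext (IH _ g1 gr) _; rewrite /g; upd_ext.
Qed.

Lemma copy_ok P o r s u f : code_at P o (copy_reg o r s u) -> f 1 = 0 ->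
  f s = 0 -> f u = 0 -> r != s -> r != u -> s != u -> s != 1 -> u != 1 ->
  r != 1 -> steps P o f (o + 7) (upd f s (f r)).
Proof.
move=> /code_at_cat [/code_at_cons [H1 /code_at_cons [H2
  /code_at_cons [H3 /code_at_cons [H4 _]]]] H5] f1 fs fu rs ru su s1 u1 r1.
have main : forall k f, f 1 = 0 -> f r = k ->
    steps P o f (o + 4) (upd (upd (upd f s (f s + k)) u (f u + k)) r 0).
  elim=> [|k IH] {f1 fs fu}f f1 Hk.
    by apply: steps_trans (steps_dec0 H1 Hk) _; apply: steps_refl; upd_ext.
  apply: steps_trans (steps_decS H1 Hk) _.
  apply: steps_trans (@steps_inc _ _ _ _ H2) _.
  apply: steps_trans (@steps_inc _ _ _ _ H3) _.
  set g := upd _ _ _.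
  have g1 : g 1 = 0 by rewrite /g !upd_neq // eq_sym.
  apply: steps_trans (steps_dec0 H4 g1) _.
  have gr : g r = k by rewrite /g 2?upd_neq ?upd_eq //.
  by apply: steps_ext (IH _ g1 gr) _; rewrite /g; upd_ext.
apply: steps_trans (main _ _ f1 erefl) _.
set g := upd _ _ _.
have g1 : g 1 = 0 by rewrite /g !upd_neq // eq_sym.
rewrite (_ : o + 7 = o + 4 + 3); last by lia.
apply: steps_ext (move_ok H5 g1 _ _ _) _ => //; first by rewrite eq_sym.
by rewrite /g; upd_ext.
Qed.

#[global] Opaque clear move_reg copy_reg.

(* The value is left in register [t]; [rho] lists the registers holding the
   environment, and all registers from [t] on are free on entry. *)
Fixpoint compile (rho : seq nat) (t o : nat) (e : expr) : seq instr :=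
  match e with
  | Var i => if i < size rho then copy_reg o (nth 0 rho i) t t.+1 else [::]
  | Zero => [::]
  | Suc a => rcons (compile rho t o a) (Inc t)
  | Let a e =>
      let ca := compile rho t o a in
      let ce := compile (t :: rho) t.+1 (o + size ca) e in
      let o2 := o + size ca + size ce in
      ca ++ ce ++ clear o2 t ++ move_reg (o2 + 2) t.+1 t
  | Del k n e => compile (take k rho ++ drop (k + n) rho) t o e
  | Rec n a s =>
      let cn := compile rho t o n in
      let ca := compile rho t.+2 (o + size cn) a in
      let o2 := o + size cn + size ca in
      let cs := compile [:: t.+2, t.+1 & rho] t.+3 o2.+1 s in
      let o3 := o2.+1 + size cs in
      cn ++ ca ++ [:: Dec t (o3 + 7)] ++ cs
         ++ clear o3 t.+2 ++ move_reg (o3 + 2) t.+3 t.+2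
         ++ [:: Inc t.+1; Dec 1 o2]
         ++ clear (o3 + 7) t.+1 ++ move_reg (o3 + 9) t.+2 t
  end.

Lemma all_take T (p : pred T) n s : all p s -> all p (take n s).
Proof. by rewrite -{1}(cat_take_drop n s) all_cat => /andP[]. Qed.

Lemma all_drop T (p : pred T) n s : all p s -> all p (drop n s).
Proof. by rewrite -{1}(cat_take_drop n s) all_cat => /andP[]. Qed.

(** Induction on [e]. The exit state differs from the entry state only in register [t], so all
    scratch registers above [t] are zero again and the fragments compose. *)
Lemma compile_ok P e : forall rho t o f,
  code_at P o (compile rho t o e) ->
  f 1 = 0 -> 2 <= t -> all (fun r => (r != 1) && (r < t)) rho ->
  (forall j, t <= j -> f j = 0) ->
  steps P o f (o + size (compile rho t o e)) (upd f t (eval (map f rho) e)).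
Proof.
elim: e => [i||a IHa|a IHa e IHe|k n e IHe|n IHn a IHa s IHs] rho t o f /=.
- case: ifP => Hi H f1 t2 Hr f0; last first.
    rewrite addn0; apply: steps_refl => j;
      rewrite nth_default ?size_map 1?leqNgt ?Hi //.
    by rewrite /upd; case: eqP => // ->; rewrite f0.
  rewrite (nth_map 0) //.
  have /andP[r1 rt] := all_nthP 0 Hr i Hi.
  rewrite size_copy; by apply: copy_ok H _ _ _ _ _ _ _ _ _ => //; rewrite ?f0 //; lia.
- move=> _ f1 t2 _ f0; rewrite addn0; apply: steps_refl => j.
  by rewrite /upd; case: eqP => // ->; rewrite f0.
- rewrite -cats1 => /code_at_cat [Ha /code_at_cons [Hi _]] f1 t2 Hr f0.
  apply: steps_trans (IHa _ _ _ _ Ha f1 t2 Hr f0) _.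
  rewrite size_cat addn1 addnS.
  by apply: steps_ext (@steps_inc _ _ _ _ Hi) _; upd_ext.
- move=> /code_at_cat [Ha /code_at_cat [He /code_at_cat [Hc Hm]]] f1 t2 Hr f0.
  rewrite size_clear in Hm.
  apply: steps_trans (IHa _ _ _ _ Ha f1 t2 Hr f0) _.
  set v := eval _ a; set g := upd f t v.
  have g1 : g 1 = 0 by rewrite /g upd_neq //; lia.
  have Hr' : all (fun r => (r != 1) && (r < t.+1)) (t :: rho).
    rewrite /= ltnSn; apply/andP; split; first by lia.
    by apply: sub_all Hr => r /andP[-> ?] /=; lia.
  have g0 j : t < j -> g j = 0 by move=> ?; rewrite /g upd_neq ?f0 //; lia.
  apply: steps_trans (IHe _ _ _ _ He g1 (leqW t2) Hr' g0) _.
  have -> : map g (t :: rho) = v :: map f rho.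
    rewrite /= /g upd_eq; congr (_ :: _).
    apply/eq_in_map => r /(allP Hr) /andP[_ rt].
    by rewrite upd_neq //; lia.
  set w := eval _ e; set h := upd g _ _.
  have h1 : h 1 = 0 by rewrite /h upd_neq //; lia.
  have t1 : t != 1 by lia.
  apply: steps_trans (clear_ok Hc h1 t1) _.
  have k1 : upd h t 0 1 = 0 by rewrite upd_neq //; lia.
  apply: (@steps_eq _ _ _ (o + size (compile rho t o a) +
    size (compile (t :: rho) t.+1 (o + size (compile rho t o a)) e) + 2 + 3)).
    apply: steps_ext (move_ok Hm k1 _ _ _) _; try lia.
    by rewrite /h /g; have := f0 t.+1 (leqW (leqnn _)) => ?; upd_ext.
  by rewrite !size_cat !size_regs; lia.
- move=> H f1 t2 Hr f0.
  rewrite -map_drop -map_take -map_cat; apply: IHe => //.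
  by rewrite all_cat all_take // all_drop.
move=> /code_at_cat [Hn /code_at_cat [Ha /code_at_cons [Hd /code_at_cat [Hs
   /code_at_cat [Hc /code_at_cat [Hm /code_at_cons [Hi /code_at_cons [Hj
   /code_at_cat [Hc2 Hm2]]]]]]]]].
move=> f1 t2 Hr f0.
set cn := compile rho t o n in Hn Ha Hd Hs Hc Hm Hi Hj Hc2 Hm2 *.
set ca := compile rho t.+2 _ a in Hn Ha Hd Hs Hc Hm Hi Hj Hc2 Hm2 *.
set o2 := o + size cn + size ca in Hn Ha Hd Hs Hc Hm Hi Hj Hc2 Hm2 *.
set cs := compile _ t.+3 _ s in Hn Ha Hd Hs Hc Hm Hi Hj Hc2 Hm2 *.
rewrite ?size_regs in Hm Hi Hj Hc2 Hm2.
set o3 := o2.+1 + size cs in Hc Hm Hi Hj Hc2 Hm2 *.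
rewrite (_ : o3 + 2 + 3 = o3 + 5) in Hi Hj Hc2 Hm2; last by lia.
rewrite (_ : (o3 + 5).+2 = o3 + 7) in Hc2 Hm2; last by lia.
rewrite (_ : o3 + 7 + 2 = o3 + 9) in Hm2; last by lia.
apply: steps_trans (IHn _ _ _ _ Hn f1 t2 Hr f0) _; rewrite -/cn.
set N := eval _ n.
have Hr2 t' : t <= t' -> all (fun r => (r != 1) && (r < t')) rho.
  by move=> tt'; apply: sub_all Hr => r /andP[-> ?] /=; lia.
have mapE g : (forall j, j < t -> g j = f j) -> map g rho = map f rho.
  by move=> E; apply/eq_in_map => r /(allP Hr) /andP[_ rt]; rewrite E.
have {}Ha := IHa rho t.+2 _ (upd f t N) Ha _ _ (Hr2 t.+2 _) _.
apply: steps_trans (Ha _ _ _ _) _; try lia.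
- by rewrite upd_neq //; lia.
- by move=> j ?; rewrite upd_neq ?f0 //; lia.
rewrite mapE -/ca -/o2; last by move=> j ?; rewrite upd_neq //; lia.
set A := eval _ a.
pose F i acc := eval (acc :: i :: map f rho) s.
(* Loop invariant: whenever control is at the test [Dec t], register [t] holds the rounds left,
   [t + 1] the current index and [t + 2] the accumulator. *)
pose G k i acc := upd (upd (upd f t k) t.+1 i) t.+2 acc.
have loop k : forall i, steps P o2 (G k i (iteri i F A)) (o3 + 7)
      (G 0 (i + k) (iteri (i + k) F A)).
  elim: k => [|k IH] i.
    rewrite addn0; apply: steps_dec0 Hd _.
    by rewrite /G 2?upd_neq ?upd_eq //; lia.
  have G1 k' i' acc' : G k' i' acc' 1 = 0 by rewrite /G !upd_neq //; lia.
  have G0 k' i' acc' j : t.+3 <= j -> G k' i' acc' j = 0.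
    by move=> ?; rewrite /G !upd_neq ?f0 //; lia.
  have GE k' i' acc' : map (G k' i' acc') [:: t.+2, t.+1 & rho] =
      [:: acc', i' & map f rho].
    rewrite /= mapE; last by move=> j ?; rewrite /G !upd_neq //; lia.
    by rewrite /G upd_eq upd_neq ?upd_eq //; lia.
  have E : G k.+1 i (iteri i F A) t = k.+1.
    by rewrite /G 2?upd_neq ?upd_eq //; lia.
  apply: steps_trans (steps_decS Hd E) _.
  have st1 : steps P o2.+1 (upd (G k.+1 i (iteri i F A)) t k) o2.+1
      (G k i (iteri i F A)).
    by apply: steps_refl; rewrite /G; upd_ext.
  apply: steps_trans st1 _.
  have Hr' : all (fun r => (r != 1) && (r < t.+3)) [:: t.+2, t.+1 & rho].
    by rewrite /= Hr2; lia.
  have t3 : 2 <= t.+3 by lia.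
  apply: steps_trans (IHs _ _ _ _ Hs (G1 _ _ _) t3 Hr' (G0 _ _ _)) _.
  rewrite -/cs -/o3 GE -/(F _ _) -iteriS.
  set v := iteri i.+1 F A; set h := upd _ _ _.
  have h1 : h 1 = 0 by rewrite /h upd_neq ?G1 //; lia.
  have t21 : t.+2 != 1 by lia.
  apply: steps_trans (clear_ok Hc h1 t21) _.
  have h2 : upd h t.+2 0 1 = 0 by rewrite upd_neq //; lia.
  have Hm' : steps P (o3 + 2) (upd h t.+2 0) (o3 + 2 + 3)
      (G k i v).
    apply: steps_ext (move_ok Hm h2 _ _ _) _; try lia.
    rewrite upd_eq upd_neq; last by lia.
    by rewrite /h upd_eq /G; have := f0 t.+3 (leqW (leqW (leqnSn t))) => ?; upd_ext.
  apply: steps_trans Hm' _; rewrite (_ : o3 + 2 + 3 = o3 + 5); last by lia.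
  apply: steps_trans (@steps_inc _ _ _ _ Hi) _.
  have GI : upd (G k i v) t.+1 (G k i v t.+1).+1 =1 G k i.+1 v.
    by rewrite /G; upd_ext.
  apply: steps_trans (@steps_refl _ _ _ _ GI) _.
  apply: steps_trans (steps_dec0 Hj (G1 _ _ _)) _.
  by rewrite -(addSnnS i k); apply: IH.
have start : upd (upd f t N) t.+2 A =1 G N 0 (iteri 0 F A).
  by rewrite /G /=; have := f0 t.+1 (leqnSn t) => ?; upd_ext.
apply: steps_trans (@steps_refl _ _ _ _ start) _.
apply: steps_trans (loop N 0) _; rewrite add0n.
set R := iteri N F A.
have G1 : G 0 N R 1 = 0 by rewrite /G !upd_neq //; lia.
have t11 : t.+1 != 1 by lia.
apply: steps_trans (clear_ok Hc2 G1 t11) _.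
have G2 : upd (G 0 N R) t.+1 0 1 = 0 by rewrite upd_neq //; lia.
rewrite (_ : o3 + 7 + 2 = o3 + 9); last by lia.
apply: (@steps_eq _ _ _ (o3 + 9 + 3)); last first.
  by do 3 rewrite ?size_cat /=; rewrite !size_regs -/cs /o3 /o2; lia.
apply: steps_ext (move_ok Hm2 G2 _ _ _) _; try lia.
rewrite /G; have := f0 t (leqnn t) => ?.
have := f0 t.+1 (leqnSn t) => ?; have := f0 t.+2 (leqW (leqnSn t)) => ?.
by upd_ext.
Qed.

(* Search for the least [z] with [eval [:: z; x] e != 0]: register 0 holds [x],
   register 2 the candidate [z]. *)
Definition search (e : expr) : seq instr :=
  let c := compile [:: 2; 0] 3 0 e in
  let o := size c in
  c ++ [:: Dec 3 (o + 9)] ++ clear o.+1 3 ++ clear (o + 3) 0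
    ++ move_reg (o + 5) 2 0 ++ [:: Dec 1 (o + 11)] ++ [:: Inc 2; Dec 1 0].

(** Expressions are total, so each test terminates; candidates are tried in increasing order and the
    search stops at the least solution. *)
Lemma search_ok e x : (exists z, eval [:: z; x] e != 0) ->
  exists2 z, eval [:: z; x] e != 0 & cm_halts_with (search e) x z.
Proof.
move=> ex; exists (ex_minn ex); first by case: ex_minnP.
case: ex_minnP => z Hz Hmin.
set P := search e; pose c := compile [:: 2; 0] 3 0 e; pose o := size c.
have : code_at P 0 P by move=> i.
rewrite {2}/P /search -/c -/o.
move=> /code_at_cat [Hc /code_at_cons [Hd /code_at_cat [Hc3 /code_at_cat [Hc0
   /code_at_cat [Hm /code_at_cons [Hj /code_at_cons [Hi /code_at_cons [Hb _]]]]]]]].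
rewrite ?size_regs !add0n -/o in Hd Hc3 Hc0 Hm Hj Hi Hb.
rewrite (_ : o.+1 + 2 = o + 3) in Hc0 Hm Hj Hi Hb; last by lia.
rewrite (_ : o + 3 + 2 = o + 5) in Hm Hj Hi Hb; last by lia.
rewrite (_ : o + 5 + 3 = o + 8) in Hj Hi Hb; last by lia.
rewrite (_ : (o + 8).+1 = o + 9) in Hi Hb; last by lia.
pose f k := upd (upd (fun _ => 0) 0 x) 2 k.
have body k : steps P 0 (f k) o (upd (f k) 3 (eval [:: k; x] e)).
  have := @compile_ok P e [:: 2; 0] 3 0 (f k) Hc.
  rewrite add0n -/c -/o; apply=> // j ?.
  by rewrite /f !upd_neq //; lia.
have loop n : n <= z -> steps P 0 (f (z - n)) 0 (f z).
  elim: n => [|n IH] nz; first by rewrite subn0; apply: steps_refl.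
  apply: steps_trans (body _) _.
  have E : eval [:: z - n.+1; x] e = 0.
    by apply/eqP/negbNE/negP => /Hmin; lia.
  rewrite E; apply: steps_trans (steps_dec0 Hd (upd_eq _ _ _)) _.
  apply: steps_trans (@steps_inc _ _ _ _ Hi) _.
  apply: steps_trans (steps_dec0 Hb _) _; first by rewrite /f.
  apply: steps_trans (IH (ltnW nz)); apply: steps_refl.
  have -> : z - n = (z - n.+1).+1 by lia.
  by rewrite /f; upd_ext.
have all_steps : steps P 0 (f 0) (o + 11) (upd (fun _ => 0) 0 z).
  have := loop z (leqnn z); rewrite subnn => L; apply: steps_trans L _.
  apply: steps_trans (body _) _.
  have [v Hv] : exists v, eval [:: z; x] e = v.+1.
    by exists (eval [:: z; x] e).-1; rewrite prednK // lt0n.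
  rewrite Hv; apply: steps_trans (steps_decS Hd (upd_eq _ _ _)) _.
  apply: steps_trans (clear_ok Hc3 _ _) _ => //.
  rewrite (_ : o.+1 + 2 = o + 3); last by lia.
  apply: steps_trans (clear_ok Hc0 _ _) _ => //.
  rewrite (_ : o + 3 + 2 = o + 5); last by lia.
  apply: steps_trans (move_ok Hm _ _ _ _) _ => //.
  rewrite (_ : o + 5 + 3 = o + 8); last by lia.
  apply: steps_trans (steps_dec0 Hj _) _ => //.
  by apply: steps_refl; rewrite /f; upd_ext.
have [|t [regs [E H]]] := all_steps [:: x].
  by case=> [|[|[|j]]] //=; rewrite nth_nil.
exists t; rewrite E /=; split; last by rewrite H.
by rewrite /P /search; do 5 rewrite ?size_cat /=; rewrite !size_regs -/c -/o; lia.
Qed.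

(** * Words and base-[b] numbers *)

(** The digits below the leading one. Since [enc] prefixes a digit 1, initial zeros of a word
    survive the coding, and dropping the leading digit recovers the word. *)
Definition word (b x : nat) : seq nat :=
  let s := trunc_log b x in mkseq (fun t => x %/ b ^ (s - t.+1) %% b) s.

Definition enc (b : nat) (w : seq nat) : nat := foldl (fun v a => v * b + a) 1 w.

(** Singles out the numbers of the form [enc b w]. Exponents up to [x] suffice because
    [l < b ^ l <= x]. *)
Definition lead1 (b x : nat) : bool := has (fun l => x %/ b ^ l == 1) (iota 0 x.+1).

Lemma eq_in_mkseq T (f g : nat -> T) n :
  (forall i, i < n -> f i = g i) -> mkseq f n = mkseq g n.
Proof. by move=> E; apply/eq_in_map => i; rewrite mem_iota add0n => /E. Qed.

Lemma has_iota_recr (p : pred nat) k :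
  has p (iota 0 k.+1) = has p (iota 0 k) || p k.
Proof. by rewrite -(addn1 k) iotaD has_cat /= orbF add0n. Qed.

Section Base.
Variable b : nat.
Hypothesis b1 : 1 < b.

Lemma shift_divn x d : d < b -> (x * b + d) %/ b = x.
Proof. by move=> db; rewrite divnMDl ?divn_small ?addn0 //; lia. Qed.

Lemma shift_modn x d : d < b -> (x * b + d) %% b = d.
Proof. by move=> db; rewrite modnMDl modn_small. Qed.

Lemma word0 : word b 0 = [::].
Proof. by rewrite /word trunc_log0. Qed.

Lemma word_shift x d : d < b ->
  word b (x * b + d) = if x == 0 then [::] else rcons (word b x) d.
Proof.
move=> db; case: eqVneq => [->|x0].
  rewrite /word mul0n add0n (_ : trunc_log b d = 0) //.
  case: d db => [|d] db; first by rewrite trunc_log0.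
  by apply: trunc_log_eq => //; rewrite expn0 expn1 db.
have sE : trunc_log b (x * b + d) = (trunc_log b x).+1.
  apply: trunc_log_eq => //.
  have x_gt0 : 0 < x by rewrite lt0n.
  have /andP[h1 h2] := trunc_log_bounds b1 x_gt0.
  rewrite !expnSr; apply/andP; split.
    by apply: leq_trans (leq_addr _ _); rewrite leq_mul2r h1 orbT.
  apply: (@leq_trans (x.+1 * b)); first by rewrite mulSn addnC ltn_add2r.
  by rewrite leq_mul2r -expnSr h2 orbT.
rewrite /word sE mkseqS subSS subnn expn0 divn1 shift_modn //; congr rcons.
apply: eq_in_mkseq => t ts; rewrite subSS.
have -> : trunc_log b x - t = (trunc_log b x - t.+1).+1 by lia.
by rewrite expnS divnMA shift_divn.
Qed.

Lemma word_enc w : all (fun a => a < b) w -> word b (enc b w) = w.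
Proof.
elim/last_ind: w => [|w a IH].
  by rewrite /enc /= /word (_ : trunc_log b 1 = 0) //; apply: trunc_log_eq.
rewrite all_rcons => /andP[ab Hw]; rewrite /enc -cats1 foldl_cat /= -/(enc b w).
rewrite word_shift // IH // cats1 ifN // -lt0n.
by elim/last_ind: w {IH Hw} => // w c IH;
  rewrite /enc -cats1 foldl_cat /= addn_gt0 muln_gt0 IH; lia.
Qed.

Lemma lead1P x : reflect (exists l, x %/ b ^ l = 1) (lead1 b x).
Proof.
apply: (iffP hasP) => [[l _ /eqP E]|[l E]]; first by exists l.
exists l; last by apply/eqP.
rewrite mem_iota add0n /=.
have : b ^ l <= x by rewrite -[b ^ l]mul1n -leq_divRL ?E // expn_gt0; lia.
by have := ltn_expl l b1; lia.
Qed.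

Lemma lead1_shift x d : d < b ->
  lead1 b (x * b + d) = if x == 0 then d == 1 else lead1 b x.
Proof.
move=> db; case: eqVneq => [->|x0].
  rewrite mul0n add0n; apply/lead1P/eqP => [[[|l]]|->]; last by exists 0.
    by rewrite divn1.
  by rewrite divn_small // expnS; apply: (leq_trans db);
    rewrite leq_pmulr // expn_gt0; lia.
apply/lead1P/lead1P => -[l E]; last by exists l.+1; rewrite expnS divnMA shift_divn.
case: l E => [|l]; last by rewrite expnS divnMA shift_divn //; exists l.
by rewrite divn1; nia.
Qed.

Lemma lead1_enc w : all (fun a => a < b) w -> lead1 b (enc b w).
Proof.
elim/last_ind: w => [|w a IH]; first by move=> _; apply/lead1P; exists 0.
rewrite all_rcons => /andP[ab Hw]; rewrite /enc -cats1 foldl_cat /= -/(enc b w).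
rewrite lead1_shift // IH //; case: eqVneq => // E.
by have := IH Hw; rewrite E => /lead1P[l]; rewrite div0n.
Qed.

Lemma enc_word x : lead1 b x -> enc b (word b x) = x.
Proof.
elim/ltn_ind: x => x.
have : x %% b < b by rewrite ltn_mod; lia.
rewrite (divn_eq x b) modnMDl modn_mod; move: (x %/ b) (x %% b) => q d db IH.
rewrite lead1_shift // word_shift //.
case: eqVneq => [->|q0]; first by rewrite mul0n => /eqP ->.
by move=> /IH E; rewrite /enc -cats1 foldl_cat /= -/(enc b _) E //; nia.
Qed.

Lemma all_word x : all (fun a => a < b) (word b x).
Proof.
apply/allP => a /mapP[t _ ->]; rewrite ltn_mod; lia.
Qed.

Lemma enc_inj w w' : all (fun a => a < b) w -> all (fun a => a < b) w' ->
  enc b w = enc b w' -> w = w'.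
Proof. by move=> /word_enc {2}<- /word_enc {2}<- ->. Qed.

Lemma pad_shift l x d : d < b ->
  pad l.+1 (word b (x * b + d)) = rcons (pad l (word b x)) ((x != 0) * d).
Proof.
move=> db; rewrite word_shift //; case: eqVneq => [->|x0] /=.
  rewrite word0 mul0n /pad !cats0 -[size _]/0 !subn0.
  by rewrite -(addn1 l) nseqD cats1.
by rewrite mul1n /pad size_rcons subSS rcons_cat.
Qed.

Lemma tuple_word_mkseq f k : tuple_word b (mkseq f k) =
  let l := \max_(j < k) size (f j) in
  mkseq (fun t => \sum_(j < k) nth 0 (pad l (f j)) t * b ^ j) l.
Proof.
rewrite /tuple_word size_mkseq.
have -> : \max_(w <- mkseq f k) size w = \max_(j < k) size (f j).
  rewrite -(big_mkord xpredT (fun j => size (f j))) /mkseq big_map.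
  by rewrite /index_iota subn0.
apply: eq_mkseq => t; apply: eq_bigr => j _.
by rewrite nth_mkseq.
Qed.

Definition twords k (x : nat -> nat) := tuple_word b (mkseq (fun j => word b (x j)) k).

(** A letter is emitted only once some track has passed its leading digit; a track that has not yet
    passed it contributes the padding 0. *)
Lemma twords_shift k x d : (forall j, d j < b) ->
  twords k (fun j => x j * b + d j) =
  if has (fun j => x j != 0) (iota 0 k)
  then rcons (twords k x) (\sum_(j < k) (x j != 0) * d j * b ^ j) else [::].
Proof.
move=> db; rewrite /twords !tuple_word_mkseq /=.
set l' := \max_(j < k) size _; set l := \max_(j < k) size _.
have lP j : j < k -> size (word b (x j)) <= l.
  by move=> jk; rewrite (leq_bigmax (Ordinal jk)).
have -> : l' = if has (fun j => x j != 0) (iota 0 k) then l.+1 else 0.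
  rewrite /l' /l; elim: k {l l' lP} => [|k IH]; first by rewrite !big_ord0.
  rewrite has_iota_recr !big_ord_recr /= IH word_shift // [size (if _ then _ else _)]fun_if size_rcons.
  have : ~~ has (fun j => x j != 0) (iota 0 k) ->
      \max_(i < k) size (word b (x i)) = 0.
    move=> /hasPn H; apply: big1 => i _.
    have ik : nat_of_ord i \in iota 0 k by rewrite mem_iota add0n ltn_ord.
    by have /negbNE/eqP -> := H _ ik; rewrite word0.
  case: has => [_|/(_ isT) ->]; case: eqVneq => [->|] //=; rewrite ?word0 /=; lia.
case: ifP => H //; rewrite mkseqS.
have szp j : j < k -> size (pad l (word b (x j))) = l.
  by move=> jk; rewrite /pad size_cat size_nseq subnK ?lP.
congr rcons; last first.
  apply: eq_bigr => j _; rewrite pad_shift // nth_rcons szp // ltnn eqxx //.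
apply: eq_in_mkseq => t tl; apply: eq_bigr => j _.
by rewrite pad_shift // nth_rcons szp // tl.
Qed.

Lemma twords0 k x : (forall j, j < k -> x j = 0) -> twords k x = [::].
Proof.
move=> H; rewrite /twords tuple_word_mkseq big1 // => j _.
by rewrite H // word0.
Qed.

Lemma eq_twords k x x' : (forall j, j < k -> x j = x' j) ->
  twords k x = twords k x'.
Proof.
by move=> H; rewrite /twords; congr tuple_word; apply: eq_in_mkseq => j /H ->.
Qed.

(** * Congruences of finite index *)

Definition congruence (Q : Type) (st : (nat -> nat) -> Q) :=
  (forall X X', X =1 X' -> st X = st X') /\
  (forall X X' D, (forall i, D i < b) -> st X = st X' ->
     st (fun i => X i * b + D i) = st (fun i => X' i * b + D i)).

Lemma congruence_shiftn Q (st : (nat -> nat) -> Q) m X X' D : congruence st ->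
  (forall i, D i < b ^ m) -> st X = st X' ->
  st (fun i => X i * b ^ m + D i) = st (fun i => X' i * b ^ m + D i).
Proof.
move=> [ext sh]; elim: m X X' D => [|m IH] X X' D Hd E.
  by rewrite (ext _ X) 1?(ext (fun i => X' i * _ + _) X') // => i;
    have := Hd i; rewrite expn0 muln1; case: (D i) => // *; rewrite addn0.
have split Z : (fun i => Z i * b ^ m.+1 + D i) =1
    (fun i => (Z i * b ^ m + D i %/ b) * b + D i %% b).
  by move=> i; rewrite mulnDl -addnA -divn_eq expnSr mulnA.
rewrite (ext _ _ (split X)) (ext _ _ (split X')); apply: sh.
  by move=> i; rewrite ltn_mod; lia.
by apply: IH => // i; rewrite ltn_divLR -?expnSr //; lia.
Qed.

(* Removing the digits between two positions, above all digits of the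
   variables outside [J], at which [st] takes the same value. *)
Lemma pumping (Q : finType) (st : (nat -> nat) -> Q) (J : pred nat) l m Y :
  congruence st ->
  (forall i, ~~ J i -> Y i < b ^ l) -> (forall i, Y i < b ^ (l + m)) ->
  exists Y', [/\ forall i, ~~ J i -> Y' i = Y i, st Y' = st Y
               & forall i, Y' i < b ^ (l + #|Q|)].
Proof.
move=> cst; have [ext _] := cst.
elim/ltn_ind: m Y => m IH Y HJ Hm.
have [mQ|Qm] := leqP m #|Q|.
  exists Y; split=> // i; apply: (leq_trans (Hm i)).
  by rewrite leq_exp2l // leq_add2l.
(* Pigeonhole on the colours seen after deleting the lowest [l + t] digits, for the [m] values of
   [t]. *)
pose g (t : 'I_m) := st (fun i => Y i %/ b ^ (l + t)).
have [t [t' [tt' gE]]] : exists t t' : 'I_m, t < t' /\ g t = g t'.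
  have /injectivePn [t [t' ne E]] : ~~ injectiveb g.
    apply/negP => /injectiveP inj.
    by have := leq_card g inj; rewrite card_ord leqNgt Qm.
  case: (ltngtP t t') => [lt|gt|e]; first by exists t, t'.
    by exists t', t.
  by rewrite (val_inj e) eqxx in ne.
(* The digits at positions [l + t] to [l + t' - 1] are cut out. A variable outside [J] has only
   zeros from position [l] on and is unchanged. *)
pose Y' i := Y i %/ b ^ (l + t') * b ^ (l + t) + Y i %% b ^ (l + t).
have pos n : 0 < b ^ n by rewrite expn_gt0; lia.
have Y'J i : ~~ J i -> Y' i = Y i.
  move=> /HJ lt; have le n : Y i < b ^ (l + n).
    by apply: leq_trans lt _; rewrite leq_exp2l // leq_addr.
  by rewrite /Y' divn_small // mul0n modn_small.
have Y'st : st Y' = st Y.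
  rewrite [RHS](ext _ (fun i => Y i %/ b ^ (l + t) * b ^ (l + t) + Y i %% b ^ (l + t))).
    apply: congruence_shiftn => // i; by rewrite ltn_mod.
  by move=> i; rewrite -divn_eq.
have tm := ltn_ord t'; have m'm : m - (t' - t) < m by lia.
have [||Z [ZJ Zst Zlt]] := IH _ m'm Y'.
- by move=> i nJ; rewrite Y'J ?HJ.
- move=> i; rewrite /Y'.
  have h1 : Y i %/ b ^ (l + t') < b ^ (m - t').
    by rewrite ltn_divLR // -expnD (_ : m - t' + (l + t') = l + m) //; lia.
  have -> : l + (m - (t' - t)) = (m - t') + (l + t) by lia.
  rewrite [X in _ < X]expnD;
    apply: (@leq_trans ((Y i %/ b ^ (l + t')).+1 * b ^ (l + t))).
    by rewrite mulSn [X in _ < X]addnC ltn_add2l ltn_mod.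
  by rewrite leq_mul2r h1 orbT.
exists Z; split=> // [i nJ|]; last by rewrite Zst.
by rewrite ZJ // Y'J.
Qed.

End Base.

(** * Formulas over coded numbers *)

Definition dfao_bounded (A : dfao) (w : nat) :=
  (d_start A <= w) && all (fun q => q <= w) (d_trans A).

(** Every state reached is the start state, a table entry, or the default 0 of a lookup outside the
    table. *)
Lemma dfao_state_le A w u : dfao_bounded A w -> dfao_state A u <= w.
Proof.
move=> /andP[hs /allP ht]; elim/last_ind: u => [|u a _] //.
rewrite /dfao_state -cats1 foldl_cat /=.
set n := (X in nth 0 _ X); have [ns|sn] := ltnP n (size (d_trans A)).
  by apply: ht; apply: mem_nth.
by rewrite nth_default.
Qed.

Lemma card_setT (T : finType) : #|{set T}| = 2 ^ #|T|.
Proof.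
rewrite -[in RHS](cardsT T) -card_powerset; apply: eq_card => A.
by rewrite !inE subsetT.
Qed.

(* Variable 0 is the prefix length and [j + 15] the [j]-th attractor position;
   1-4, 5-10 and 11-14 are blocks of bound variables.  [FEx fl lo hi f]
   quantifies the variables from [lo] below [hi]; if [fl] holds, the number of
   distinct attractor positions must also decrease. *)
Inductive fm :=
  | FAdd of nat & nat & nat
  | FOut of nat & nat
  | FMem of nat
  | FRep of nat
  | FRepAll
  | FAcc
  | FNot of fm
  | FAnd of fm & fm
  | FEx of bool & nat & nat & fm.

Fixpoint depth f := match f with
  | FNot f => depth f
  | FAnd f g => maxn (depth f) (depth g)
  | FEx _ _ _ f => (depth f).+1
  | _ => 0
  end.

Fixpoint wf V f := match f with
  | FAdd i j k => [&& i < V, j < V & k < V]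
  | FOut i j => (i < V) && (j < V)
  | FMem i | FRep i => i < V
  | FRepAll | FAcc => true
  | FNot f => wf V f
  | FAnd f g => wf V f && wf V g
  | FEx _ lo hi f => [&& lo < 16, hi < 16 & wf V f]
  end.

(* [hi = 0] stands for a block reaching up to the last variable. *)
Definition inJ V lo hi i := [&& lo <= i, i < V & (hi == 0) || (i < hi)].

(** [tri] and [trk] send a track of a tuple word to the variable written on it; for [trk] these are
    the prefix length and then the positions, which start at variable 15. *)
Definition tri (i j k m : nat) := if m == 0 then i else if m == 1 then j else k.
Definition trk (m : nat) := if m == 0 then 0 else m + 14.

Lemma trk_lt c j : j < c.+1 -> trk j < c + 15.
Proof. by rewrite /trk; case: eqP => ?; lia. Qed.

Definition card_ps c (X : nat -> nat) :=
  \sum_(j < c) ~~ has (fun j' => X (j' + 15) == X (j + 15)) (iota 0 j).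

(** The number of colours at quantifier depth [d]. At depth 0 there are three states and three bits
    for each triple of variables, and one state of the candidate automaton; each further level adds
    a set of colours for each of the [16 * 16 = 256] pairs of block limits. *)
Fixpoint tower w V d :=
  if d is d'.+1 then tower w V d' * (2 ^ tower w V d') ^ 256
  else (w.+1 ^ 3 * 8) ^ (V ^ 3) * w.+1.

Section Formulas.
Variables (b c : nat) (L A S B : dfao).
Let V := c + 15.

Definition run (M : dfao) k (x : nat -> nat) := dfao_state M (twords b k x).
Definition racc M k x := nth 0 (d_out M) (run M k x) != 0.
Definition repb x := lead1 b x && racc L 1 (fun _ => x).

Fixpoint holds (X : nat -> nat) f : Prop := match f with
  | FAdd i j k => [&& repb (X i), repb (X j), repb (X k)
                    & racc A 3 (fun m => X (tri i j k m))]
  | FOut i j => nth 0 (d_out S) (run S 1 (fun _ => X i)) =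
                nth 0 (d_out S) (run S 1 (fun _ => X j))
  | FMem i => has (fun j => X (j + 15) == X i) (iota 0 c)
  | FRep i => repb (X i)
  | FRepAll => all (fun j => repb (X (trk j))) (iota 0 c.+1)
  | FAcc => racc B c.+1 (fun m => X (trk m))
  | FNot f => ~ holds X f
  | FAnd f g => holds X f /\ holds X g
  | FEx fl lo hi f => exists Y, [/\ forall i, ~~ inJ V lo hi i -> Y i = X i,
      fl -> card_ps c Y < card_ps c X & holds Y f]
  end.

Section Levels.
Hypothesis b1 : 1 < b.
Variable w : nat.
Hypothesis bL : dfao_bounded L w.
Hypothesis bA : dfao_bounded A w.
Hypothesis bS : dfao_bounded S w.
Hypothesis bB : dfao_bounded B w.

Lemma run_le M k x : dfao_bounded M w -> run M k x <= w.
Proof. exact: dfao_state_le. Qed.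

Lemma run_shift M k x d : (forall j, d j < b) ->
  run M k (fun j => x j * b + d j) =
  if has (fun j => x j != 0) (iota 0 k)
  then nth 0 (d_trans M) (run M k x * d_letters M
             + \sum_(j < k) (x j != 0) * d j * b ^ j)
  else d_start M.
Proof.
move=> db; rewrite /run twords_shift //; case: ifP => // _.
by rewrite /dfao_state -cats1 foldl_cat.
Qed.

Lemma eq_run M k x x' : (forall j, j < k -> x j = x' j) -> run M k x = run M k x'.
Proof. by move=> E; rewrite /run (eq_twords b E). Qed.

(** Besides the states behind the atomic formulas, tests are recorded that make these data
    computable after a shift: whether a number is zero tells whether its track has begun. *)
Definition atoms X i j k : nat * nat * nat * bool * bool * bool :=
  (run A 3 (fun m => X (tri i j k m)), run L 1 (fun _ => X i),
   run S 1 (fun _ => X i), X i == 0, lead1 b (X i), X i == X j).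

Definition same0 X X' :=
  (forall i j k, i < V -> j < V -> k < V -> atoms X i j k = atoms X' i j k) /\
  run B c.+1 (fun m => X (trk m)) = run B c.+1 (fun m => X' (trk m)).

Definition code_atoms (v : nat * nat * nat * bool * bool * bool) :
    'I_w.+1 * 'I_w.+1 * 'I_w.+1 * bool * bool * bool :=
  let: (x, y, z, t, u, v) := v in (inord x, inord y, inord z, t, u, v).

Definition st0 X :
  {ffun 'I_V * 'I_V * 'I_V ->
    'I_w.+1 * 'I_w.+1 * 'I_w.+1 * bool * bool * bool} * 'I_w.+1 :=
  ([ffun t : 'I_V * 'I_V * 'I_V => code_atoms (atoms X t.1.1 t.1.2 t.2)],
   inord (run B c.+1 (fun m => X (trk m)))).

Lemma st0P X X' : st0 X = st0 X' <-> same0 X X'.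
Proof.
have inord_inj x y : x <= w -> y <= w -> (inord x : 'I_w.+1) = inord y -> x = y.
  by move=> xw yw /(congr1 val) /=; rewrite !inordK.
split=> [[/ffunP E1 E2]|[E1 E2]]; last first.
  by congr (_, _); [apply/ffunP => t; rewrite !ffunE E1|rewrite E2].
split; last by apply: inord_inj E2; apply: run_le.
move=> i j k iV jV kV; have := E1 (Ordinal iV, Ordinal jV, Ordinal kV).
rewrite !ffunE /= => -[/inord_inj h1 /inord_inj h2 /inord_inj h3 h4 h5 h6].
rewrite /atoms (h1 (run_le _ _ bA) (run_le _ _ bA)).
rewrite (h2 (run_le _ _ bL) (run_le _ _ bL)) (h3 (run_le _ _ bS) (run_le _ _ bS)).
by rewrite h4 h5 h6.
Qed.

Lemma tri_lt i j k m : i < V -> j < V -> k < V -> tri i j k m < V.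
Proof. by rewrite /tri; case: eqP => // _; case: eqP. Qed.

Section Same.
Variables X X' : nat -> nat.
Hypothesis E : same0 X X'.

Lemma same_zero i : i < V -> (X i == 0) = (X' i == 0).
Proof. by move=> iV; have [_ _ _ -> _ _] := E.1 i i i iV iV iV. Qed.

Lemma same_eq i j : i < V -> j < V -> (X i == X j) = (X' i == X' j).
Proof. by move=> iV jV; have [_ _ _ _ _ ->] := E.1 i j i iV jV iV. Qed.

Lemma same_rep i : i < V -> repb (X i) = repb (X' i).
Proof. by move=> iV; rewrite /repb /racc;
  have [_ -> _ _ -> _] := E.1 i i i iV iV iV. Qed.

Lemma same_card : card_ps c X = card_ps c X'.
Proof.
apply: eq_bigr => j _; congr (nat_of_bool (~~ _)); apply: eq_in_has => j'.
rewrite mem_iota add0n => /andP[_ jj']; have jc := ltn_ord j.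
by apply: same_eq; rewrite ltn_add2r // (ltn_trans jj').
Qed.

(** The next state depends on the old state, the digits, and which tracks are nonzero; the latter is
    fixed by [same0]. *)
Lemma same_run M k ix D : (forall m, m < k -> ix m < V) -> (forall i, D i < b) ->
  run M k (fun m => X (ix m)) = run M k (fun m => X' (ix m)) ->
  run M k (fun m => X (ix m) * b + D (ix m)) =
  run M k (fun m => X' (ix m) * b + D (ix m)).
Proof.
move=> ixV Db R; rewrite !(@run_shift _ _ _ (fun m => D (ix m))) // R.
have Eh : {in iota 0 k, forall m, (X (ix m) != 0) = (X' (ix m) != 0)}.
  by move=> m; rewrite mem_iota add0n => /andP[_ mk]; rewrite same_zero ?ixV.
rewrite (eq_in_has Eh); case: ifP => // _; congr (nth 0 _ (_ + _)).
by apply: eq_bigr => m _; rewrite Eh // mem_iota add0n ltn_ord.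
Qed.

Lemma same_shift D : (forall i, D i < b) ->
  same0 (fun i => X i * b + D i) (fun i => X' i * b + D i).
Proof.
move=> Db; have eq0 x d : (x * b + d == 0) = (x == 0) && (d == 0).
  by rewrite addn_eq0 muln_eq0; lia.
have eqs x y d e : d < b -> e < b ->
    (x * b + d == y * b + e) = (x == y) && (d == e).
  move=> db eb; apply/eqP/andP => [H|[/eqP -> /eqP ->] //].
  have := congr1 (divn^~ b) H; have := congr1 (modn^~ b) H.
  by rewrite /= !shift_divn // !shift_modn // => -> ->.
split; last first.
  by apply: (@same_run _ _ trk) => //; [exact: trk_lt|exact: E.2].
move=> i j k iV jV kV; rewrite /atoms.
have [R1 R2 R3 _ Hl _] := E.1 i j k iV jV kV.
rewrite (@same_run _ _ (tri i j k)) //; last by move=> *; exact: tri_lt.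
rewrite (@same_run _ _ (fun _ => i)) // (@same_run _ _ (fun _ => i)) //.
by rewrite !eq0 !eqs // !lead1_shift // Hl (same_eq iV jV) (same_zero iV).
Qed.

End Same.

Lemma same0_ext X X' : X =1 X' -> same0 X X'.
Proof.
move=> E; split=> [i j k _ _ _|]; last by apply: eq_run => m _; rewrite E.
rewrite /atoms !E; congr (_, _, _, _, _, _).
by apply: eq_run => m _; rewrite E.
Qed.

Lemma congruence_st0 : congruence b st0.
Proof.
split=> [X X' /same0_ext E|X X' D Db /st0P E]; first by apply/st0P.
by apply/st0P; apply: same_shift.
Qed.

Definition refines (Q : Type) (st : (nat -> nat) -> Q) :=
  forall X X', st X = st X' -> same0 X X'.

Definition saturates (Q : Type) (st : (nat -> nat) -> Q) f :=
  forall X X', st X = st X' -> holds X f -> holds X' f.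

Lemma saturates0 (Q : Type) (st : (nat -> nat) -> Q) f :
  refines st -> depth f = 0 -> wf V f -> saturates st f.
Proof.
move=> ref; elim: f => [i j k|i j|i|i|||f IH|f IHf g IHg|fl lo hi f IH] //=.
- move=> _ /and3P[iV jV kV] X X' /ref E.
  rewrite /= !(same_rep E) // /racc; by have [-> _ _ _ _ _] := E.1 i j k iV jV kV.
- move=> _ /andP[iV jV] X X' /ref E /=.
  have [_ _ -> _ _ _] := E.1 i i i iV iV iV.
  by have [_ _ -> _ _ _] := E.1 j j j jV jV jV.
- move=> _ iV X X' /ref E /=;
    rewrite (@eq_in_has _ _ (fun j => X' (j + 15) == X' i)) //.
  by move=> j; rewrite mem_iota add0n => /andP[_ jc]; apply: same_eq E _ _ _ _ => //;
    rewrite /V; lia.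
- by move=> _ iV X X' /ref E /=; rewrite (same_rep E).
- move=> _ _ X X' /ref E; rewrite /holds.
  rewrite (@eq_in_all _ _ (fun j => repb (X' (trk j)))) // => j.
  by rewrite mem_iota add0n => /andP[_ jc]; apply: same_rep => //; apply: trk_lt.
- by move=> _ _ X X' /ref E /=; rewrite /racc E.2.
- move=> d0 wff X X' E /= nf H; apply: nf; exact: (IH d0 wff _ _ (esym E)).
- move=> d0 /andP[wff wfg] X X' E /= [Hf Hg].
  by split; [apply: IHf E Hf|apply: IHg E Hg] => //; lia.
Qed.

(** The colours reachable from [X] by changing only the variables of a block: the subset
    construction for an existential quantifier. *)
Definition pset (Q : finType) (st : (nat -> nat) -> Q) lo hi X : {set Q} :=
  [set q | `[< exists Y, (forall i, ~~ inJ V lo hi i -> Y i = X i) /\ st Y = q >]].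

Lemma psetP (Q : finType) (st : (nat -> nat) -> Q) lo hi X X' Y :
  pset st lo hi X = pset st lo hi X' ->
  (forall i, ~~ inJ V lo hi i -> Y i = X i) ->
  exists2 Y', forall i, ~~ inJ V lo hi i -> Y' i = X' i & st Y' = st Y.
Proof.
move=> /setP/(_ (st Y)); rewrite !inE => H HY.
have : `[< exists Y', (forall i, ~~ inJ V lo hi i -> Y' i = X' i) /\ st Y' = st Y >].
  by rewrite -H; apply/asboolP; exists Y.
by move=> /asboolP [Y' [? ?]]; exists Y'.
Qed.

Lemma eq_pset (Q : finType) (st : (nat -> nat) -> Q) lo hi X X' :
  (forall Y, (forall i, ~~ inJ V lo hi i -> Y i = X i) ->
     exists2 Y', forall i, ~~ inJ V lo hi i -> Y' i = X' i & st Y' = st Y) ->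
  (forall Y, (forall i, ~~ inJ V lo hi i -> Y i = X' i) ->
     exists2 Y', forall i, ~~ inJ V lo hi i -> Y' i = X i & st Y' = st Y) ->
  pset st lo hi X = pset st lo hi X'.
Proof.
move=> H1 H2; apply/setP => q; rewrite !inE.
apply/asboolP/asboolP => -[Y [HY <-]].
  by have [Y' ? ?] := H1 Y HY; exists Y'.
by have [Y' ? ?] := H2 Y HY; exists Y'.
Qed.

(** All blocks with limits below 16 are handled at once, so one colouring serves every formula of
    the next depth; [wf] demands such limits. *)
Definition lift (Q : finType) (st : (nat -> nat) -> Q) X :=
  (st X, [ffun p : 'I_16 * 'I_16 => pset st p.1 p.2 X]).

Lemma lift_pset (Q : finType) (st : (nat -> nat) -> Q) lo hi X X' :
  lift st X = lift st X' -> lo < 16 -> hi < 16 ->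
  pset st lo hi X = pset st lo hi X'.
Proof.
by move=> [_ /ffunP E] l h; have := E (Ordinal l, Ordinal h); rewrite !ffunE.
Qed.

(** A variant of a shifted assignment splits into quotients and last digits. Equality of the colour
    sets moves the quotients to the other assignment, and putting the same last digits back keeps
    the colour because [st] is a congruence. *)
Lemma congruence_lift (Q : finType) (st : (nat -> nat) -> Q) :
  congruence b st -> congruence b (lift st).
Proof.
move=> [ext sh]; split=> [X X' E|X X' D Db EL].
  congr (_, _); first exact: ext.
  apply/ffunP => p; rewrite !ffunE; apply: eq_pset => Y HY.
    by exists Y => // i /HY ->.
  by exists Y => // i /HY ->.
congr (_, _); first by apply: sh => //; case: EL.
apply/ffunP => -[lo hi]; rewrite !ffunE /=.
have {EL} EL := lift_pset EL (ltn_ord lo) (ltn_ord hi).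
have main Z Z' Y : pset st lo hi Z = pset st lo hi Z' ->
    (forall i, ~~ inJ V lo hi i -> Y i = Z i * b + D i) ->
    exists2 Y', forall i, ~~ inJ V lo hi i -> Y' i = Z' i * b + D i & st Y' = st Y.
  move=> EZ HY; pose Y1 i := Y i %/ b; pose D1 i := Y i %% b.
  have [|Y2 H2 E2] := psetP (Y := Y1) EZ.
    by move=> i /HY E; rewrite /Y1 E shift_divn.
  exists (fun i => Y2 i * b + D1 i).
    by move=> i nJ; rewrite H2 // /D1 HY // shift_modn.
  rewrite [RHS](ext _ (fun i => Y1 i * b + D1 i)).
    by apply: sh => // i; rewrite ltn_mod; lia.
  by move=> i; rewrite -divn_eq.
by apply: eq_pset => Y; apply: main.
Qed.

(** A witness is carried over through the colour sets; the counting condition survives because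
    [same0] determines the number of distinct positions. *)
Lemma saturates_lift (Q : finType) (st : (nat -> nat) -> Q) d :
  refines st ->
  (forall f, wf V f -> depth f <= d -> saturates st f) ->
  forall f, wf V f -> depth f <= d.+1 -> saturates (lift st) f.
Proof.
move=> ref IH; elim=> [i j k|i j|i|i|||f IHf|f IHf g IHg|fl lo hi f IHf].
1-6: by move=> wff _; apply: saturates0 => // X X' [/ref E _].
- by move=> wff df X X' E nH H; apply: nH; apply: (IHf wff df _ _ (esym E)).
- move=> /andP[wff wfg] df X X' E [Hf Hg]; rewrite /= geq_max in df.
  have [df1 df2] := andP df.
  by split; [apply: IHf E Hf|apply: IHg E Hg].
move=> /and3P[l16 h16 wff] df X X' E [Y [HY Hc Hf]].
have [Y' HY' EY] := psetP (lift_pset E l16 h16) HY.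
exists Y'; split=> //; last by apply: (IH _ wff df _ _ (esym EY)).
move=> /Hc; rewrite (same_card (ref _ _ EY)).
by case: E => /ref/same_card ->.
Qed.

Lemma levels d : exists (Q : finType) (st : (nat -> nat) -> Q),
  [/\ #|Q| = tower w V d, congruence b st, refines st
    & forall f, wf V f -> depth f <= d -> saturates st f].
Proof.
elim: d => [|d [Q [st [cQ cst ref sat]]]].
  exists _, st0; split.
  - by rewrite !card_prod card_ffun !card_prod !card_ord card_bool /= !expnS expn0;
      congr (_ * _); congr (_ ^ _); lia.
  - exact: congruence_st0.
  - by move=> X X' /st0P.
  - move=> f wff; rewrite leqn0 => /eqP df; apply: saturates0 => //.
    by move=> X X' /st0P.
exists _, (lift st); split.
- by rewrite !card_prod card_ffun card_setT !card_prod !card_ord cQ.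
- exact: congruence_lift.
- by move=> X X' [/ref].
- exact: saturates_lift.
Qed.

End Levels.
End Formulas.

(** * Derived operations of the language *)

(* Locking keeps unification from unfolding one operator into another. *)
Definition Wk := locked (fun n e => Del 0 n e).
Definition eConst := locked (fun n => iter n Suc Zero).
Definition eAdd := locked (fun a d => Rec d a (Suc (Var 0))).
Definition eMul := locked (fun a d => Rec d Zero (eAdd (Var 0) (Wk 2 a))).
Definition eExp := locked (fun a d =>
  Rec d (Suc Zero) (eMul (Var 0) (Wk 2 a))).
Definition ePred := locked (fun a => Rec a Zero (Var 1)).
Definition eSub := locked (fun a d => Rec d a (ePred (Var 0))).
(** The loop discards its accumulator, so any positive number of rounds yields [a]. *)
Definition eIf := locked (fun t a d => Rec t d (Wk 2 a)).
Definition eNot := locked (fun a => eIf a Zero (Suc Zero)).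
Definition eBool := locked (fun a => eIf a (Suc Zero) Zero).
Definition eAnd := locked (fun a d => eIf a (eBool d) Zero).
Definition eOr := locked (fun a d => eIf a (Suc Zero) (eBool d)).
Definition eLe := locked (fun a d => eNot (eSub a d)).
Definition eEq := locked (fun a d => eAnd (eLe a d) (eLe d a)).
Definition eSum := locked (fun n f => Rec n Zero (eAdd (Var 0) (Wk 1 f))).
Definition eEx := locked (fun n f => eBool (eSum n f)).
(** The quotient counts the [i] with [(i + 1) * d <= a]; for [d = 0] the result is 0, in agreement
    with [%/]. *)
Definition eDiv := locked (fun a d =>
  eIf d (eSum a (eLe (eMul (Suc (Var 0)) (Wk 1 d)) (Wk 1 a))) Zero).
Definition eMod := locked (fun a d => eSub a (eMul (eDiv a d) d)).

Section Eval.
Variable env : seq nat.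
Implicit Types a d f : expr.

Lemma eval_var i : eval env (Var i) = nth 0 env i. Proof. by []. Qed.

Lemma eval_zero : eval env Zero = 0. Proof. by []. Qed.

Lemma eval_suc a : eval env (Suc a) = (eval env a).+1. Proof. by []. Qed.

Lemma eval_let a d : eval env (Let a d) = eval (eval env a :: env) d.
Proof. by []. Qed.

Lemma eval_wk n a : eval env (Wk n a) = eval (drop n env) a.
Proof. by rewrite /Wk -lock /= take0. Qed.

Lemma eval_const n : eval env (eConst n) = n.
Proof. by rewrite /eConst -lock; elim: n => //= n ->. Qed.

Lemma eval_rec n a f : eval env (Rec n a f) =
  iteri (eval env n) (fun i acc => eval (acc :: i :: env) f) (eval env a).
Proof. by []. Qed.
End Eval.

Lemma iteri_sum n (F : nat -> nat) x : iteri n (fun i acc => acc + F i) x = x + \sum_(i < n) F i.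
Proof.
by elim: n => [|n /= ->]; rewrite ?big_ord0 ?addn0 // big_ord_recr /= addnA.
Qed.

Lemma eval_add env a d : eval env (eAdd a d) = eval env a + eval env d.
Proof. by rewrite /eAdd -lock /=; elim: (eval env d) => [|n /= ->];
  rewrite ?addn0 ?addnS. Qed.

Lemma eval_mul env a d : eval env (eMul a d) = eval env a * eval env d.
Proof.
rewrite /eMul -lock eval_rec -[RHS]add0n.
elim: (eval env d) => [|n IH]; first by rewrite muln0.
rewrite iteriS IH eval_add eval_wk eval_var !add0n mulnS [RHS]addnC /= ?drop0 //.
Qed.

Lemma eval_exp env a d : eval env (eExp a d) = eval env a ^ eval env d.
Proof.
rewrite /eExp -lock eval_rec; elim: (eval env d) => [|n IH] //.
by rewrite iteriS IH eval_mul eval_wk eval_var /= ?drop0 expnSr.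
Qed.

Lemma eval_pred env a : eval env (ePred a) = (eval env a).-1.
Proof. by rewrite /ePred -lock /=; case: (eval env a). Qed.

Lemma eval_sub env a d : eval env (eSub a d) = eval env a - eval env d.
Proof.
rewrite /eSub -lock eval_rec; elim: (eval env d) => [|n IH]; first by rewrite subn0.
by rewrite iteriS IH eval_pred eval_var /= subnS.
Qed.

Lemma eval_if env t a d :
  eval env (eIf t a d) = if eval env t != 0 then eval env a else eval env d.
Proof.
rewrite /eIf -lock eval_rec; case: (eval env t) => [|n] //.
by rewrite iteriS eval_wk /= ?drop0.
Qed.

Lemma eval_not env a : eval env (eNot a) = (eval env a == 0).
Proof. by rewrite /eNot -lock eval_if; case: eqP. Qed.

Lemma eval_bool env a : eval env (eBool a) = (eval env a != 0).
Proof. by rewrite /eBool -lock eval_if; case: eqP. Qed.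

Lemma eval_and env a d : eval env (eAnd a d) = (eval env a != 0) && (eval env d != 0).
Proof. by rewrite /eAnd -lock eval_if eval_bool; case: ifP. Qed.

Lemma eval_or env a d : eval env (eOr a d) = (eval env a != 0) || (eval env d != 0).
Proof. by rewrite /eOr -lock eval_if eval_bool; case: ifP. Qed.

Lemma eval_le env a d : eval env (eLe a d) = (eval env a <= eval env d).
Proof. by rewrite /eLe -lock eval_not eval_sub. Qed.

Lemma eval_eq env a d : eval env (eEq a d) = (eval env a == eval env d).
Proof. by rewrite /eEq -lock eval_and !eval_le !eqb0 !negbK eqn_leq. Qed.

Lemma eval_sum env n f :
  eval env (eSum n f) = \sum_(i < eval env n) eval (nat_of_ord i :: env) f.
Proof.
rewrite /eSum -lock eval_rec.
rewrite (eq_iteri (f' := fun i acc => acc + eval (i :: env) f)) ?iteri_sum //.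
by move=> i acc; rewrite eval_add eval_wk /= ?drop0.
Qed.

Lemma eval_ex env n f :
  eval env (eEx n f) = has (fun i => eval (i :: env) f != 0) (iota 0 (eval env n)).
Proof.
rewrite /eEx -lock eval_bool eval_sum; congr nat_of_bool.
elim: (eval env n) => [|m IH]; first by rewrite big_ord0.
by rewrite big_ord_recr has_iota_recr -IH addn_eq0 negb_and.
Qed.

Lemma sum_ltn n q : \sum_(i < n) (i < q) = minn n q.
Proof.
elim: n => [|n IH]; first by rewrite big_ord0 min0n.
by rewrite big_ord_recr /= IH; lia.
Qed.

Lemma eval_div env a d : eval env (eDiv a d) = eval env a %/ eval env d.
Proof.
rewrite /eDiv -lock eval_if; case: eqVneq => [->|d0]; first by rewrite divn0.
rewrite eval_sum (eq_bigr (fun i : 'I_(eval env a) => nat_of_bool (i < eval env a %/ eval env d))).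
  by rewrite sum_ltn; apply/minn_idPr; apply: leq_div.
move=> i _; rewrite eval_le eval_mul eval_suc !eval_wk eval_var /= ?drop0.
by rewrite leq_divRL ?lt0n.
Qed.

Lemma eval_mod env a d : eval env (eMod a d) = eval env a %% eval env d.
Proof.
rewrite /eMod -lock eval_sub eval_mul eval_div {1}(divn_eq (eval env a) (eval env d)).
by rewrite addKn.
Qed.

Definition evalE := (eval_var, eval_zero, eval_suc, eval_wk, eval_const,
  eval_ex, eval_eq, eval_le, eval_and, eval_or, eval_not, eval_bool,
  eval_mod, eval_div, eval_sub, eval_pred, eval_exp, eval_mul, eval_add,
  eval_if).

(** * Decoding lists and automata *)

(** The equation [(pairn x y).+1 = z] multiplied by 2, which removes the division in the Cantor
    pairing. By injectivity of the pairing, the sums in [chd] and [ctl] have at most one nonzero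
    term. *)
Definition pair_test z x y := (x + y) * (x + y).+1 + y * 2 + 2 == z * 2.
Definition chd z := \sum_(x < z) x * has (pair_test z x) (iota 0 z).
Definition ctl z := \sum_(y < z) y * has (pair_test z ^~ y) (iota 0 z).
Definition nthc z i := chd (iter i ctl z).

Lemma pairnE x y : pairn x y * 2 = (x + y) * (x + y).+1 + y * 2.
Proof.
rewrite /pairn mulnDl divnK //; by rewrite dvdn2 oddM /= andbN.
Qed.

Lemma pair_testE z x y : pair_test z x y = ((pairn x y).+1 == z).
Proof.
rewrite /pair_test -pairnE -(@eqn_pmul2r 2 _ z) // mulSn.
by rewrite addnC.
Qed.

Lemma pairn_inj x y x' y' : pairn x y = pairn x' y' -> x = x' /\ y = y'.
Proof.
move=> /(congr1 (muln^~ 2)); rewrite !pairnE => E.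
have E1 : x + y = x' + y'.
  by case: (ltngtP (x + y) (x' + y')) => // lt; nia.
by split; nia.
Qed.

Lemma leq_pairn x y : x + y <= pairn x y.
Proof. by have := pairnE x y; nia. Qed.

Lemma pairn_surj z : exists x y, pairn x y = z.
Proof.
elim: z => [|z [x [y E]]]; first by exists 0, 0.
have H (x1 y1 x2 y2 : nat) : pairn x1 y1 * 2 + 2 = pairn x2 y2 * 2 ->
    pairn x2 y2 = (pairn x1 y1).+1 by lia.
case: x E => [|x] <-.
  by exists y.+1, 0; apply: H; rewrite !pairnE; nia.
by exists x, y.+1; apply: H; rewrite !pairnE; nia.
Qed.

Lemma code_seq_surj z : exists s, code_seq s = z.
Proof.
elim/ltn_ind: z => -[|z] IH; first by exists [::].
have [x [y E]] := pairn_surj z.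
have [|s Es] := IH y; first by have := leq_pairn x y; lia.
by exists (x :: s); rewrite /= Es E.
Qed.

Lemma chd_code s : chd (code_seq s) = head 0 s.
Proof.
case: s => [|x s]; first by rewrite /chd big_ord0.
set z := code_seq _; have lexy := leq_pairn x (code_seq s).
have xz : x < z by rewrite /z /=; lia.
rewrite /chd (bigD1 (Ordinal xz)) // big1 ?addn0 -?[nat_of_ord (Ordinal xz)]/x.
  have -> : has (pair_test z x) (iota 0 z); last by rewrite /= muln1 addn0.
  apply/hasP; exists (code_seq s); last by rewrite pair_testE.
  by rewrite mem_iota /= /z /=; lia.
move=> i ne; apply/eqP; rewrite muln_eq0 eqb0; apply/orP; right; apply/hasPn => y _.
rewrite pair_testE; apply/eqP => -[/pairn_inj [E _]].
by case/eqP: ne; apply: val_inj.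
Qed.

Lemma ctl_code s : ctl (code_seq s) = code_seq (behead s).
Proof.
case: s => [|x s]; first by rewrite /ctl big_ord0.
set z := code_seq (x :: s); have lexy := leq_pairn x (code_seq s).
have xz : code_seq s < z by rewrite /z /=; lia.
rewrite /ctl (bigD1 (Ordinal xz)) // big1 ?addn0 -?[nat_of_ord (Ordinal xz)]/(code_seq s).
  have -> : has (pair_test z ^~ (code_seq s)) (iota 0 z);
    last by rewrite /= muln1 addn0.
  apply/hasP; exists x; last by rewrite pair_testE.
  by rewrite mem_iota /= /z /=; lia.
move=> i ne; apply/eqP; rewrite muln_eq0 eqb0; apply/orP; right; apply/hasPn => y _.
rewrite pair_testE; apply/eqP => -[/pairn_inj [_ E]].
by case/eqP: ne; apply: val_inj.
Qed.

Lemma iter_ctl_code i s : iter i ctl (code_seq s) = code_seq (drop i s).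
Proof.
elim: i s => [|i IH] s; first by rewrite drop0.
by rewrite iterSr ctl_code IH; case: s.
Qed.

Lemma nthc_code s i : nthc (code_seq s) i = nth 0 s i.
Proof. by rewrite /nthc iter_ctl_code chd_code -nth0 nth_drop addn0. Qed.

Lemma nthc0 i : nthc 0 i = 0.
Proof. by rewrite (nthc_code [::]) nth_nil. Qed.

Lemma mem_code_seq s x : x \in s -> x <= code_seq s.
Proof.
elim: s => //= y s IH; rewrite inE; have := leq_pairn y (code_seq s).
by move=> h /orP[/eqP ->|/IH]; lia.
Qed.

Definition eTest := locked (fun z x y =>
  eEq (eAdd (eAdd (eMul (eAdd x y) (Suc (eAdd x y))) (eMul y (eConst 2))) (eConst 2))
      (eMul z (eConst 2))).
Definition eHd := locked (fun z =>
  eSum z (eMul (Var 0) (eEx (Wk 1 z) (eTest (Wk 2 z) (Var 1) (Var 0))))).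
Definition eTl := locked (fun z =>
  eSum z (eMul (Var 0) (eEx (Wk 1 z) (eTest (Wk 2 z) (Var 0) (Var 1))))).
Definition eTls := locked (fun z i => Rec i z (eTl (Var 0))).
Definition eNth := locked (fun z i => eHd (eTls z i)).

Lemma eval_test env z x y :
  eval env (eTest z x y) = pair_test (eval env z) (eval env x) (eval env y).
Proof. by rewrite /eTest -lock !evalE. Qed.

Lemma eval_hd env z : eval env (eHd z) = chd (eval env z).
Proof.
rewrite /eHd -lock eval_sum; apply: eq_bigr => x _; rewrite !evalE /=.
rewrite ?drop0; congr (_ * nat_of_bool _); apply: eq_has => y.
by rewrite eval_test !evalE /= ?drop0 eqb0 negbK.
Qed.

Lemma eval_tl env z : eval env (eTl z) = ctl (eval env z).
Proof.
rewrite /eTl -lock eval_sum; apply: eq_bigr => x _; rewrite !evalE /=.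
rewrite ?drop0; congr (_ * nat_of_bool _); apply: eq_has => y.
by rewrite eval_test !evalE /= ?drop0 eqb0 negbK.
Qed.

Lemma eval_tls env z i : eval env (eTls z i) = iter (eval env i) ctl (eval env z).
Proof.
rewrite /eTls -lock eval_rec; elim: (eval env i) => //= n ->.
by rewrite eval_tl.
Qed.

Lemma eval_nth env z i : eval env (eNth z i) = nthc (eval env z) (eval env i).
Proof. by rewrite /eNth -lock eval_hd eval_tls. Qed.

(** In the code the output table follows the transitions directly, so the length stored at index 2
    is tested to get the default 0 beyond the transition table. *)
Definition ctrans z k := if k < nthc z 2 then nthc z (k + 3) else 0.
Definition cout z k := nthc z (nthc z 2 + k + 3).

Definition codes z (M : dfao) := [/\ nthc z 0 = d_letters M, nthc z 1 = d_start M,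
  ctrans z =1 nth 0 (d_trans M) & cout z =1 nth 0 (d_out M)].

Lemma codes_code_dfao M : codes (code_dfao M) M.
Proof.
rewrite /codes /ctrans /cout /code_dfao; split=> [||k|k]; rewrite !nthc_code //=.
  rewrite addn3 /= nth_cat; case: ltnP => // H.
  by rewrite nth_default.
by rewrite addn3 /= nth_cat ltnNge leq_addr /= addKn.
Qed.

(** Lets the decision procedure, which involves no candidate automaton, run with the number 0 in its
    place. *)
Lemma codes0 : codes 0 (DFAO 0 0 [::] [::]).
Proof.
by split=> [||k|k]; rewrite /ctrans /cout !nthc0 //= nth_nil.
Qed.

Lemma code_dfao_bounded M w : code_dfao M <= w -> dfao_bounded M w.
Proof.
move=> le;
  have H x : x \in [:: d_letters M, d_start M, size (d_trans M) & d_trans M ++ d_out M] -> x <= w.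
  by move=> /mem_code_seq h; apply: leq_trans h le.
apply/andP; split; first by apply: H; rewrite !inE eqxx orbT.
by apply/allP => q qM; apply: H; rewrite !inE mem_cat qM !orbT.
Qed.

(* Every number codes a list, so it only remains to test that the announced
   transition table fits; the test also forces a nonempty output table. *)
Definition is_code z := iter (nthc z 2) ctl (iter 3 ctl z) != 0.

Lemma is_codeP z : is_code z -> exists M, z = code_dfao M.
Proof.
have [s <-] := code_seq_surj z; rewrite /is_code !iter_ctl_code nthc_code.
case: s => [|l [|st [|n s]]]; rewrite ?drop0 //=.
rewrite drop0 => H; exists (DFAO l st (take n s) (drop n s)).
rewrite /code_dfao /= cat_take_drop size_take ifT //.
by rewrite ltnNge; apply/negP => /drop_oversize E; rewrite E in H.
Qed.

Lemma code_dfao_is_code M : d_out M != [::] -> is_code (code_dfao M).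
Proof.
move=> H; rewrite /is_code /code_dfao !iter_ctl_code nthc_code /= ?drop0.
by rewrite drop_size_cat //; case: (d_out M) H.
Qed.

(** * Running an automaton on several tracks *)

Definition crun z b T k (x : nat -> nat) :=
  iteri T (fun i q =>
    if has (fun j => x j %/ b ^ (T - i.+1).+1 != 0) (iota 0 k)
    then ctrans z (q * nthc z 0 + \sum_(j < k)
           (x j %/ b ^ (T - i.+1).+1 != 0) * (x j %/ b ^ (T - i.+1) %% b) * b ^ j)
    else q) (nthc z 1).

(** After [i] rounds the state is that of the run on the numbers without their lowest [T - i]
    digits; surplus rounds at the beginning find all tracks zero and keep the start state. *)
Lemma crun_ok b M z T k x : 1 < b -> codes z M ->
  (forall j, j < k -> x j < b ^ T) -> crun z b T k x = run b M k x.
Proof.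
move=> b1 [h0 h1 h2 _] xT.
suff H i : i <= T -> iteri i (fun i q =>
    if has (fun j => x j %/ b ^ (T - i.+1).+1 != 0) (iota 0 k)
    then ctrans z (q * nthc z 0 + \sum_(j < k)
           (x j %/ b ^ (T - i.+1).+1 != 0) * (x j %/ b ^ (T - i.+1) %% b) * b ^ j)
    else q) (nthc z 1) = run b M k (fun j => x j %/ b ^ (T - i)).
  rewrite /crun H // subnn; apply: eq_run => j _; by rewrite divn1.
elim: i => [|i IH] iT.
  rewrite /= h1 /run twords0 // => j jk.
  by rewrite subn0 divn_small // xT.
rewrite iteriS IH; last by lia.
have TE : T - i = (T - i.+1).+1 by lia.
rewrite (@eq_run b _ _ (fun j => x j %/ b ^ (T - i.+1))
  (fun j => x j %/ b ^ (T - i) * b + x j %/ b ^ (T - i.+1) %% b)); last first.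
  by move=> j _; rewrite TE expnSr divnMA -divn_eq.
rewrite run_shift //; last by move=> j; rewrite ltn_mod; lia.
rewrite TE; case: ifP => [_|/negbT/hasPn H]; first by rewrite h0 h2.
rewrite /run twords0 // => j jk; apply/eqP/negbNE/H.
by rewrite mem_iota add0n.
Qed.

Definition eTrans := locked (fun z k =>
  eIf (eLe (Suc k) (eNth z (eConst 2))) (eNth z (eAdd k (eConst 3))) Zero).
Definition eOut := locked (fun z k =>
  eNth z (eAdd (eAdd (eNth z (eConst 2)) k) (eConst 3))).

(* [f] computes the number on track [j], with [j] as variable 0. *)
Definition eRun := locked (fun z b T k f =>
  let t := eSub (Wk 3 T) (Suc (Var 2)) in
  let high := eBool (eDiv (Del 1 2 f) (eExp (Wk 3 b) (Suc t))) in
  let digit := eMod (eDiv (Del 1 2 f) (eExp (Wk 3 b) t)) (Wk 3 b) in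
  Rec T (eNth z (eConst 1))
    (eIf (eEx (Wk 2 k) high)
       (eTrans (Wk 2 z) (eAdd (eMul (Var 0) (eNth (Wk 2 z) (eConst 0)))
          (eSum (Wk 2 k) (eMul (eMul high digit) (eExp (Wk 3 b) (Var 0))))))
       (Var 0))).

Lemma eval_trans env z k : eval env (eTrans z k) = ctrans (eval env z) (eval env k).
Proof. by rewrite /eTrans -lock !evalE !eval_nth !evalE /ctrans eqb0 negbK. Qed.

Lemma eval_out env z k : eval env (eOut z k) = cout (eval env z) (eval env k).
Proof. by rewrite /eOut -lock eval_nth !evalE eval_nth evalE. Qed.

Lemma eval_del12 env j q i f : eval [:: j, q, i & env] (Del 1 2 f) = eval (j :: env) f.
Proof. by rewrite /= ?drop0. Qed.

Lemma eval_run env z b T k f : eval env (eRun z b T k f) =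
  crun (eval env z) (eval env b) (eval env T) (eval env k)
    (fun j => eval (j :: env) f).
Proof.
rewrite /eRun -lock eval_rec eval_nth evalE; apply: eq_iteri => i q.
rewrite eval_if eval_ex eval_trans eval_add eval_mul eval_nth eval_sum !evalE /= ?drop0.
rewrite eqb0 negbK; congr (if _ then ctrans _ (_ + _) else _).
  apply: eq_has => j; rewrite eval_bool eval_div eval_del12 !evalE /= ?drop0.
  by rewrite eqb0 negbK.
apply: eq_bigr => j _.
by rewrite !eval_mul eval_bool eval_mod !eval_div !eval_del12 !evalE /= ?drop0.
Qed.

(** * Bounded evaluation of formulas *)

Definition dig K a i := a %/ K ^ i %% K.

Lemma dig_lt K a i : 0 < K -> dig K a i < K.
Proof. by move=> K0; rewrite ltn_mod. Qed.

Lemma dig_high K a n i : 0 < K -> a < K ^ n -> n <= i -> dig K a i = 0.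
Proof.
move=> K0 an ni; rewrite /dig divn_small ?mod0n //.
by apply: leq_trans an _; rewrite leq_pexp2l.
Qed.

Lemma dig_exists K n (Y : nat -> nat) : (forall i, i < n -> Y i < K) ->
  exists2 a, a < K ^ n & forall i, i < n -> dig K a i = Y i.
Proof.
elim: n Y => [|n IH] Y HY; first by exists 0.
have [|a an Ha] := IH (fun i => Y i.+1); first by move=> i ?; apply: HY; lia.
have Y0 := HY 0 (ltn0Sn n).
exists (a * K + Y 0).
  rewrite expnSr; apply: (@leq_trans (a.+1 * K)); last by rewrite leq_mul2r an orbT.
  by rewrite mulSn addnC ltn_add2r.
case=> [|i] iN; first by rewrite /dig divn1 modnMDl modn_small.
rewrite -Ha // /dig expnS divnMA divnMDl ?(divn_small Y0) ?addn0 //; lia.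
Qed.

Lemma leq_tower w V d D : d <= D -> tower w V d <= tower w V D.
Proof.
move=> /subnK <-; elim: (D - d) => // n IH; apply: leq_trans IH _.
by rewrite addSn /= leq_pmulr // expn_gt0 expn_gt0.
Qed.

Definition eDig := locked (fun K a i => eMod (eDiv a (eExp K i)) K).
Definition eLead := locked (fun b x =>
  eEx (Suc x) (eEq (eDiv (Wk 1 x) (eExp (Wk 1 b) (Var 0))) (Suc Zero))).
Definition eTrk := locked (fun m => eIf m (eAdd m (eConst 14)) Zero).
Definition eTri := locked (fun i j k m =>
  eIf m (eIf (ePred m) (eConst k) (eConst j)) (eConst i)).

Lemma eval_dig env K a i :
  eval env (eDig K a i) = dig (eval env K) (eval env a) (eval env i).
Proof. by rewrite /eDig -lock !evalE. Qed.

Lemma eval_lead env b x : eval env (eLead b x) = lead1 (eval env b) (eval env x).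
Proof.
rewrite /eLead -lock eval_ex; congr nat_of_bool; apply: eq_has => l.
by rewrite !evalE /= ?drop0 eqb0 negbK.
Qed.

Lemma eval_trk env m : eval env (eTrk m) = trk (eval env m).
Proof. by rewrite /eTrk -lock !evalE /trk; case: eqP. Qed.

Lemma eval_tri env i j k m : eval env (eTri i j k m) = tri i j k (eval env m).
Proof. by rewrite /eTri -lock !evalE /tri; case: (eval env m) => [|[|]]. Qed.

(* Environment: assignment [a] in base [K], growth factor [C] of the bounds,
   base [b], number [c] of positions, and codes of the automata. *)
Definition fenv a K C b c zL zA zS zB (rest : seq nat) :=
  [:: a, K, C, b, c, zL, zA, zS, zB & rest].

(* Below, [n] variables have been pushed on top of the environment. *)
Definition eX := locked (fun n i => eDig (Var n.+1) (Var n) i).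
(** The number of rounds is the bound [K] itself: values below [K] are below [b ^ K], so this many
    digits always suffice. *)
Definition eAcc := locked (fun n z k f =>
  eOut (Var (n + z)) (eRun (Var (n + z)) (Var (n + 3)) (Var n.+1) k f)).
Definition eRep := locked (fun n i =>
  eAnd (eLead (Var (n + 3)) (eX n i)) (eAcc n 5 (Suc Zero) (eX n.+1 (Wk 1 i)))).
Definition eInJ := locked (fun V lo hi i =>
  eAnd (eLe (eConst lo) i)
    (eAnd (eLe (Suc i) V) (if hi == 0 then Suc Zero else eLe (Suc i) (eConst hi)))).
Definition eCard := locked (fun n c =>
  eSum c (eNot (eEx (Var 0)
    (eEq (eX n.+2 (eAdd (Var 0) (eConst 15))) (eX n.+2 (eAdd (Var 1) (eConst 15))))))).

(** A quantifier ranges over assignments in base [K * C], that is, with as many extra digits as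
    there are colours. [Del 2 2] removes the old assignment and its base, so the body sees the
    layout of [fenv] again. *)
Fixpoint fe (f : fm) : expr := match f with
  | FAdd i j k => eAnd (eRep 0 (eConst i)) (eAnd (eRep 0 (eConst j))
      (eAnd (eRep 0 (eConst k)) (eAcc 0 6 (eConst 3) (eX 1 (eTri i j k (Var 0))))))
  | FOut i j => eEq (eAcc 0 7 (eConst 1) (eX 1 (eConst i)))
                    (eAcc 0 7 (eConst 1) (eX 1 (eConst j)))
  | FMem i => eEx (Var 4) (eEq (eX 1 (eAdd (Var 0) (eConst 15))) (eX 1 (eConst i)))
  | FRep i => eRep 0 (eConst i)
  | FRepAll => eNot (eEx (Suc (Var 4)) (eNot (eRep 1 (eTrk (Var 0)))))
  | FAcc => eAcc 0 8 (Suc (Var 4)) (eX 1 (eTrk (Var 0)))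
  | FNot f => eNot (fe f)
  | FAnd f g => eAnd (fe f) (fe g)
  | FEx fl lo hi f =>
      let agree := eNot (eEx (eAdd (Var 6) (eConst 15)) (eNot
        (eOr (eInJ (eAdd (Var 7) (eConst 15)) lo hi (Var 0))
             (eEq (eX 1 (Var 0)) (eX 3 (Var 0)))))) in
      let fewer := if fl then eLe (Suc (eCard 0 (Var 6))) (eCard 2 (Var 6))
                   else Suc Zero in
      Let (eMul (Var 1) (Var 2))
        (eEx (eExp (Var 0) (eAdd (Var 5) (eConst 15)))
           (eAnd agree (eAnd fewer (Del 2 2 (fe f)))))
  end.

Section FormulaEval.
Variables (b c : nat) (L A S B : dfao) (zL zA zS zB w D : nat).
Let V := c + 15.
Let C := b ^ tower w V D.
Hypothesis b1 : 1 < b.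
Hypothesis cL : codes zL L.
Hypothesis cA : codes zA A.
Hypothesis cS : codes zS S.
Hypothesis cB : codes zB B.
Hypothesis bL : dfao_bounded L w.
Hypothesis bA : dfao_bounded A w.
Hypothesis bS : dfao_bounded S w.
Hypothesis bB : dfao_bounded B w.

Lemma eval_X pre a K rest i :
  eval (pre ++ a :: K :: rest) (eX (size pre) i) =
  dig K a (eval (pre ++ a :: K :: rest) i).
Proof.
rewrite /eX -lock eval_dig !eval_var !nth_cat ltnn subnn.
by rewrite ltnNge leqnSn /= subSn // subnn.
Qed.

Lemma eval_card pre a K rest e : eval (pre ++ a :: K :: rest) e = c ->
  eval (pre ++ a :: K :: rest) (eCard (size pre) e) = card_ps c (dig K a).
Proof.
move=> E; rewrite /eCard -lock eval_sum E; apply: eq_bigr => j _.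
rewrite !evalE eqb0; congr (nat_of_bool (~~ _)); apply: eq_has => j'.
rewrite eval_eq -[(size pre).+2]/(size [:: j', nat_of_ord j & pre]) -!cat_cons.
by rewrite !eval_X !evalE eqb0 negbK.
Qed.

Section Atoms.
Variables (pre : seq nat) (a l : nat) (rest : seq nat).
Let K := b ^ l.
Let env := pre ++ fenv a K C b c zL zA zS zB rest.

Let K_gt0 : 0 < K. Proof. by rewrite expn_gt0; lia. Qed.

Lemma eval_acc z k f x M zM : 3 <= z -> nth 0 [:: b; c; zL; zA; zS; zB] (z - 3) = zM ->
  codes zM M -> z < 9 ->
  (forall j, eval (j :: env) f = x j) -> (forall j, x j < K) ->
  eval env (eAcc (size pre) z k f) = nth 0 (d_out M) (run b M (eval env k) x).
Proof.
move=> z3 zE cM z9 fE xK; rewrite /eAcc -lock eval_out eval_run !eval_var.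
have nE n v : nth 0 [:: a, K, C, b, c, zL, zA, zS, zB & rest] n = v ->
    nth 0 env (size pre + n) = v.
  by rewrite /env nth_cat ltnNge leq_addr /= addKn.
rewrite (nE z zM); last first.
  rewrite -zE; move: z z3 z9 {zE} => [|[|[|[|[|[|[|[|[|z]]]]]]]]] //.
rewrite (nE 3 b) // -addn1 (nE 1 K) //.
have [_ _ _ ->] := cM; congr (nth 0 _ _).
rewrite (crun_ok (M := M)) //.
  by apply: eq_run => j _; rewrite fE.
by move=> j _; rewrite fE; apply: ltn_trans (xK j) (ltn_expl K b1).
Qed.

Lemma eval_rep i : eval env (eRep (size pre) i) = repb b L (dig K a (eval env i)).
Proof.
rewrite /eRep -lock eval_and eval_lead; congr nat_of_bool.
rewrite {3}/env eval_X eval_var {1}/env nth_cat ltnNge leq_addr /= addKn /=.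
rewrite eqb0 negbK /repb /racc; congr (_ && _).
rewrite (@eval_acc _ _ _ (fun _ => dig K a (eval env i)) L zL) //.
  move=> j; rewrite -[(size pre).+1]/(size (j :: pre)) -cat_cons eval_X.
  by rewrite /= evalE /= drop0.
by move=> _; apply: dig_lt.
Qed.

End Atoms.

Lemma fe_ok f a l rest : wf V f -> depth f <= D -> a < (b ^ l) ^ V ->
  eval (fenv a (b ^ l) C b c zL zA zS zB rest) (fe f) != 0 <->
  holds b c L A S B (dig (b ^ l) a) f.
Proof.
have digK n a' i : dig (b ^ n) a' i < b ^ n.
  by apply: dig_lt; rewrite expn_gt0; lia.
have nb (p : bool) : (nat_of_bool p != 0) = p by rewrite eqb0 negbK.
elim: f a l rest => [i j k|i j|i|i|||f IH|f IHf g IHg|fl lo hi f IHf] a l rest wff df aK.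
- rewrite /= !eval_and !nb !(eval_rep [::]) !nb !eval_const.
  rewrite (@eval_acc [::] a l rest 6 _ _ (fun m => dig (b ^ l) a (tri i j k m)) A zA) //.
    by rewrite !evalE.
  by move=> m; rewrite (eval_X [:: m]) eval_tri.
- rewrite /= eval_eq nb.
  rewrite (@eval_acc [::] a l rest 7 _ _ (fun m => dig (b ^ l) a i) S zS) //;
    last first.
    by move=> m; rewrite (eval_X [:: m]) eval_const.
  rewrite (@eval_acc [::] a l rest 7 _ _ (fun m => dig (b ^ l) a j) S zS) //;
    last first.
    by move=> m; rewrite (eval_X [:: m]) eval_const.
  by rewrite !evalE; split=> [/eqP|->].
- rewrite /= eval_ex nb (@eq_has _ _ (fun j => dig (b ^ l) a (j + 15) == dig (b ^ l) a i)) //.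
  by move=> j; rewrite eval_eq !(eval_X [:: j]) !evalE nb.
- by rewrite /= (eval_rep [::]) nb !evalE.
- rewrite /fe eval_not nb eval_ex eqb0 -all_predC /holds.
  rewrite (@eq_all _ _ (fun j => repb b L (dig (b ^ l) a (trk j)))) // => j.
  by rewrite /= eval_not (eval_rep [:: j]) eval_trk nb eqb0 negbK.
- rewrite /= (@eval_acc [::] a l rest 8 _ _ (fun m => dig (b ^ l) a (trk m)) B zB) //.
  by move=> m; rewrite (eval_X [:: m]) eval_trk.
- rewrite /= eval_not nb -[_ == 0]negbK; split.
    by move=> /negP nH /(IH _ _ rest wff df aK).
  by move=> nH; apply/negP => /(IH _ _ rest wff df aK).
- have [wff1 wff2] := andP wff; move: df; rewrite /= geq_max => /andP[df1 df2].
  rewrite eval_and nb; split.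
    by move=> /andP[/(IHf _ _ rest wff1 df1 aK) h1 /(IHg _ _ rest wff2 df2 aK) h2].
  by move=> [/(IHf _ _ rest wff1 df1 aK) -> /(IHg _ _ rest wff2 df2 aK) ->].
have [l16 h16 wff1] := and3P wff.
pose l' := l + tower w V D; set K := b ^ l; pose K' := b ^ l'.
have K'E : K * C = K' by rewrite /K /C -expnD.
have K0 n : 0 < b ^ n by rewrite expn_gt0; lia.
rewrite /fe -/fe eval_let eval_ex nb.
have -> : eval (fenv a K C b c zL zA zS zB rest) (eMul (Var 1) (Var 2)) = K'.
  by rewrite evalE !eval_var.
rewrite eval_exp eval_add eval_const !eval_var -[nth 0 _ 0]/K' -[nth 0 _ 5]/c -/V.
pose P a' := [&& all (fun i => inJ V lo hi i || (dig K' a' i == dig K a i)) (iota 0 V),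
  fl ==> (card_ps c (dig K' a') < card_ps c (dig K a)) &
  eval (fenv a' K' C b c zL zA zS zB rest) (fe f) != 0].
rewrite (@eq_has _ _ P); last first.
  move=> a'; rewrite !eval_and !nb /P eval_not nb eval_ex eqb0 -all_predC.
  congr [&& _, _ & _].
  - rewrite eval_add eval_const eval_var -[nth 0 _ 6]/c -/V; apply: eq_all => i.
    rewrite /= eval_not nb eval_or eqb0 negbK eval_eq nb.
    rewrite (eval_X [:: i]) (eval_X [:: i; a'; K']) eval_var; congr (_ || _).
    rewrite /eInJ -lock !eval_and !nb !eval_le !nb eval_add !eval_const !eval_suc !eval_var.
    rewrite /inJ -[nth 0 _ 0]/i -[nth 0 _ 7]/c -/V; case: (eqVneq hi 0) => [//|_].
    by rewrite /= eval_le nb eval_suc eval_const.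
  - case: (fl) => /=; last by []. rewrite eval_le nb eval_suc.
    by rewrite (eval_card (pre := [::])) // (eval_card (pre := [:: a'; K'])).
split.
  move=> /hasP[a']; rewrite mem_iota add0n => /andP[_ a'V] /and3P[/allP Hag Hfl].
  move=> /(IHf _ l' rest wff1 (ltnW df) a'V) Hf; exists (dig K' a'); split=> //.
    move=> i nJ; have [iV|Vi] := ltnP i V; last first.
      by rewrite (dig_high (K0 _) a'V Vi) (dig_high (K0 _) aK Vi).
    by have := Hag i; rewrite mem_iota add0n iV (negbTE nJ) => /(_ isT)/eqP.
  by move=> fl1; move: Hfl; rewrite fl1.
move=> [Y [HY Hfl Hf]].
(* Completeness of the bounded search: an arbitrary witness [Y] is pumped down to one with few
   digits, which has the same colour and hence still satisfies [f]. *)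
have [Q [st [cQ cst ref sat]]] :=
  @levels b c L A S B b1 w bL bA bS bB (depth f).
(* Any number of digits that holds all of [Y] will do; variables from [V] on lie outside every block
   and are below [b ^ l] already. *)
pose m := \sum_(i < V) Y i.
have YJ i : ~~ inJ V lo hi i -> Y i < b ^ l by move=> /HY ->; apply: digK.
have Ym i : Y i < b ^ (l + m).
  have [/andP[_ /andP[iV _]]|nJ] := boolP (inJ V lo hi i).
    have le : Y i <= m by rewrite /m (bigD1 (Ordinal iV)) //= leq_addr.
    have := ltn_expl (l + m) b1; lia.
  by apply: leq_trans (YJ i nJ) _; rewrite leq_exp2l // leq_addr.
have [Y' [Y'J Y'st Y'lt]] := pumping b1 cst YJ Ym.
have Y'K i : Y' i < K'.
  apply: leq_trans (Y'lt i) _; rewrite leq_exp2l // leq_add2l cQ.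
  by apply: leq_tower; apply: ltnW.
have [a' a'V Ha'] := @dig_exists K' V Y' (fun i _ => Y'K i).
have E : dig K' a' =1 Y'.
  move=> i; have [iV|Vi] := ltnP i V; first exact: Ha'.
  rewrite (dig_high _ a'V) ?K0 // Y'J ?HY ?(dig_high _ aK) ?K0 //;
    by rewrite /inJ ltnNge Vi andbF.
have E' : st (dig K' a') = st Y by rewrite -Y'st; apply: cst.1.
apply/hasP; exists a'; first by rewrite mem_iota add0n.
apply/and3P; split.
- apply/allP => i _; have [//|nJ] := boolP (inJ V lo hi i).
  by rewrite /= E Y'J // HY.
- by apply/implyP => /Hfl; rewrite (same_card (ref _ _ E')).
- apply/(IHf _ l' rest wff1 (ltnW df) a'V).
  by apply: sat (esym E') Hf.
Qed.

End FormulaEval.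

(** * The meaning of the formulas *)

(* Variables 1-4 are [p, l, p + l, n - (p + l)] for a factor, 5-10 are
   [p', p' + l, n - (p' + l), i, i - p', p' + l - i] for an occurrence of it
   meeting the position [i], and 11-14 are [k, l - k, p + k, p' + k]. *)
Definition fDiffer := FEx false 11 15 (FAnd (FAdd 11 12 2)
  (FAnd (FNot (FAdd 12 12 12)) (FAnd (FAdd 1 11 13)
  (FAnd (FAdd 5 11 14) (FNot (FOut 13 14)))))).
(** Order is expressed through sums: each inequality gets a difference variable, and
    [FNot (FAdd i i i)] makes it positive, since [m + m = m] only for 0. The unnegated sums also
    force these variables to be codes. *)
Definition fOcc := FEx false 5 11 (FAnd (FAdd 5 2 6) (FAnd (FAdd 6 7 0)
  (FAnd (FMem 8) (FAnd (FAdd 5 9 8) (FAnd (FAdd 8 10 6)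
  (FAnd (FNot (FAdd 10 10 10)) (FNot fDiffer))))))).
Definition fAttr := FNot (FEx false 1 5 (FAnd (FAdd 1 2 3) (FAnd (FAdd 3 4 0)
  (FAnd (FNot (FAdd 2 2 2)) (FNot fOcc))))).
Definition fMin := FAnd fAttr (FNot (FEx true 15 0 fAttr)).
Definition fAll := FNot (FEx false 0 1 (FAnd (FRep 0)
  (FNot (FEx false 15 0 fAttr)))).
(** The limits [0 0] denote the block of all variables, so every length and every tuple is
    tested. *)
Definition fCheck := FNot (FEx false 0 0 (FAnd FRepAll
  (FNot (FAnd (FNot (FAnd FAcc (FNot fMin))) (FNot (FAnd (FNot FAcc) fMin)))))).

Lemma tuple_word1 b w : tuple_word b [:: w] = w.
Proof.
rewrite /tuple_word big_cons big_nil maxn0 /= -[RHS](@mkseq_nth _ 0 w).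
apply: eq_mkseq => t; rewrite big_ord1 /= expn0 muln1.
by rewrite /pad subnn.
Qed.

Lemma pad_cat m l w : size w <= m -> m <= l -> pad l w = nseq (l - m) 0 ++ pad m w.
Proof.
by move=> wm ml; rewrite /pad catA -nseqD; congr (nseq _ _ ++ _); lia.
Qed.

Lemma size_pad l w : size w <= l -> size (pad l w) = l.
Proof. by move=> h; rewrite /pad size_cat size_nseq subnK. Qed.

Lemma card_psE c X : card_ps c X = size (undup (mkseq (fun j => X (j + 15)) c)).
Proof.
elim: c => [|c IH]; first by rewrite /card_ps big_ord0.
rewrite mkseqS /card_ps big_ord_recr /= -/(card_ps c X) IH.
set s := mkseq _ c; set x := X _.
have -> : size (undup (rcons s x)) = size (undup (x :: s)).
  apply/perm_size/uniq_perm; rewrite ?undup_uniq // => y.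
  by rewrite !mem_undup mem_rcons.
have -> : has (fun j' => X (j' + 15) == x) (iota 0 c) = (x \in s).
  by apply/hasP/mapP => [[j jc /eqP <-]|[j jc ->]]; exists j.
by rewrite /=; case: ifP => /=; lia.
Qed.

Definition setv (X : nat -> nat) lo (vs : seq nat) i :=
  if (lo <= i) && (i < lo + size vs) then nth 0 vs (i - lo) else X i.

Section Semantics.
Variables (b c : nat) (L A S B : dfao) (rep : nat -> seq nat).
Hypothesis reg : regular_numeration b rep L A.
Let V := c + 15.
Let s := auto_seq S rep.

Let rep_inj : injective rep. Proof. by case: reg. Qed.
Let rep_lt n : all (fun a => a < b) (rep n). Proof. by case: reg. Qed.

(* [0 + y = y] is accepted, and the padded word for [0 + x = y] is the same. *)
Lemma rep_pad_inj l x y : size (rep x) <= l -> size (rep y) <= l ->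
  pad l (rep x) = pad l (rep y) -> x = y.
Proof.
wlog le : x y / size (rep x) <= size (rep y).
  move=> W xl yl E; case: (leqP (size (rep x)) (size (rep y))) => [|/ltnW] h.
    exact: W.
  by apply/esym; apply: W.
move=> xl yl E; set m := size (rep y) in le yl.
have Em : pad m (rep x) = pad m (rep y).
  have := E; rewrite (pad_cat le yl) (@pad_cat m l (rep y)) // => /eqP.
  by rewrite eqseq_cat // => /andP[_ /eqP].
have [_ _ _ /(_ 0 x y)] := reg.
have -> : tuple_word b [:: rep 0; rep x; rep y] = tuple_word b [:: rep 0; rep y; rep y].
  rewrite /tuple_word !big_cons big_nil !maxn0 /=.
  have -> : maxn (size (rep x)) (size (rep y)) = m by apply/maxn_idPr.
  rewrite maxnn -/m; apply: eq_mkseq => t; rewrite !big_ord_recl big_ord0 /=.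
  congr (_ + (nth 0 _ _ * _ + _)).
  by rewrite (pad_cat le (leq_maxr _ _)) (@pad_cat m _ (rep y)) ?leq_maxr // Em.
by have [_ _ _ /(_ 0 y y) ->] := reg => -[/(_ erefl)].
Qed.

(** Over at most one letter all words consist of zeros, so [rep 0] and [rep 1] agree after padding,
    against [rep_pad_inj]. *)
Lemma base_gt1 : 1 < b.
Proof.
case: (leqP b 1) => // b1; suff : 0 = 1 by [].
have E n : rep n = nseq (size (rep n)) 0.
  apply/all_pred1P/allP => a /(allP (rep_lt n)) ab.
  by move: (leq_trans ab b1); rewrite /= ltnS leqn0.
apply: (@rep_pad_inj (maxn (size (rep 0)) (size (rep 1)))).
- exact: leq_maxl.
- exact: leq_maxr.
by rewrite E (E 1) /pad !size_nseq -!nseqD !subnK ?leq_maxl ?leq_maxr.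
Qed.
Let b1 := base_gt1.

Definition ncode n := enc b (rep n).

Lemma ncode_inj : injective ncode.
Proof. by move=> m n /(enc_inj b1 (rep_lt m) (rep_lt n)) /rep_inj. Qed.

Lemma word_ncode n : word b (ncode n) = rep n.
Proof. by rewrite word_enc. Qed.

Lemma ncode_neq0 n : ncode n != 0.
Proof.
apply/eqP => E; have := lead1_enc b1 (rep_lt n); rewrite -/(ncode n) E.
by move=> /(lead1P b1) [l]; rewrite div0n.
Qed.

Lemma repbP x : reflect (exists n, x = ncode n) (repb b L x).
Proof.
have H : racc b L 1 (fun _ => x) = dfa_accepts L (word b x).
  by rewrite /racc /run /twords tuple_word1.
have [_ _ HL _] := reg; apply: (iffP andP); rewrite H => -[].
  move=> l1 /(HL _ (all_word b1 x)) [n E]; exists n.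
  by rewrite /ncode E enc_word.
move=> n ->; rewrite lead1_enc //; split=> //.
by rewrite word_ncode; apply/HL => //; exists n.
Qed.

Notation holds := (holds b c L A S B).

Lemma holds_add X i j k : holds X (FAdd i j k) <->
  exists m n, [/\ X i = ncode m, X j = ncode n & X k = ncode (m + n)].
Proof.
have [_ _ _ HA] := reg.
have H x y z : X i = ncode x -> X j = ncode y -> X k = ncode z ->
    racc b A 3 (fun m => X (tri i j k m)) <-> z = x + y.
  move=> xE yE zE; rewrite -HA /racc /run /twords /mkseq /=.
  by rewrite xE yE zE !word_ncode.
split=> /=.
  move=> /and4P[/repbP[x xE] /repbP[y yE] /repbP[z zE]].
  by move=> /(H _ _ _ xE yE zE) zxy; exists x, y; rewrite -zxy.
move=> [x [y [xE yE zE]]]; apply/and4P; split; try by apply/repbP; eexists; eassumption.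
exact/(H _ _ _ xE yE zE).
Qed.

Lemma holds_addv X i j k m n p : X i = ncode m -> X j = ncode n -> X k = ncode p ->
  holds X (FAdd i j k) <-> p = m + n.
Proof.
move=> E1 E2 E3; rewrite holds_add; split=> [[m' [n' []]]|E].
  by rewrite E1 E2 E3 => /ncode_inj -> /ncode_inj -> /ncode_inj.
by exists m, n; rewrite -E E3.
Qed.

Lemma out_v n : nth 0 (d_out S) (run b S 1 (fun _ => ncode n)) = s n.
Proof. by rewrite /run /twords tuple_word1 word_ncode. Qed.

Lemma setv_out X lo hi vs i : hi = lo + size vs -> hi <= V ->
  ~~ inJ V lo hi i -> setv X lo vs i = X i.
Proof.
move=> -> hV; rewrite /setv /inJ; case: ifP => // /andP[-> h] /=.
by rewrite h (leq_trans h hV) orbT.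
Qed.

Lemma differP X p l p' : X 1 = ncode p -> X 2 = ncode l -> X 5 = ncode p' ->
  holds X fDiffer <-> exists2 k, k < l & s (p' + k) <> s (p + k).
Proof.
move=> X1 X2 X5; split=> [[Y [HY _]]|[k kl ne]].
  have Y1 : Y 1 = ncode p by rewrite HY.
  have Y2 : Y 2 = ncode l by rewrite HY.
  have Y5 : Y 5 = ncode p' by rewrite HY.
  case=> [/holds_add [k [m [k1 m1]]]]; rewrite Y2 => /ncode_inj lE.
  case=> m0; case=> h1; case=> h2 nout.
  have [? [? [_ _ y1]]] := (holds_add Y 1 11 13).1 h1.
  have [? [? [_ _ y2]]] := (holds_add Y 5 11 14).1 h2.
  exists k.
    case: m m1 lE m0 => [|m] m1 lE m0; last by rewrite lE addnS ltnS leq_addr.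
    by case: m0; apply/(holds_addv m1 m1 m1).
  move: nout; rewrite /= y1 y2 !out_v => nout.
  rewrite -((holds_addv Y1 k1 y1).1 h1) -((holds_addv Y5 k1 y2).1 h2) => E.
  by apply: nout.
pose Y := setv X 11 [:: ncode k; ncode (l - k); ncode (p + k); ncode (p' + k)].
exists Y; split=> //; first by move=> i; apply: setv_out; rewrite /V //=; lia.
have Y1 : Y 1 = ncode p by rewrite -X1.
have Y2 : Y 2 = ncode l by rewrite -X2.
have Y5 : Y 5 = ncode p' by rewrite -X5.
split; first by apply/(@holds_addv Y 11 12 2 k (l - k) l) => //; lia.
split;
  first by move=> /(@holds_addv Y 12 12 12 (l - k) (l - k) (l - k) erefl erefl erefl); lia.
split; first by apply/(@holds_addv Y 1 11 13 p k (p + k)).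
split; first by apply/(@holds_addv Y 5 11 14 p' k (p' + k)).
by rewrite /= /Y /setv /= !out_v => E; apply: ne.
Qed.

Definition vals (X : nat -> nat) := mkseq (fun j => X (j + 15)) c.

(* The set of positions whose codes occur in [vs] is an attractor of the
   prefix of length [n]. *)
Definition attr n (vs : seq nat) := forall p l, 0 < l -> p + l <= n ->
  exists p', [/\ p' + l <= n, forall k, k < l -> s (p' + k) = s (p + k)
               & exists2 i, ncode i \in vs & p' <= i < p' + l].

Lemma occP X n p l : X 0 = ncode n -> X 1 = ncode p -> X 2 = ncode l ->
  holds X fOcc <->
  exists p', [/\ p' + l <= n, forall k, k < l -> s (p' + k) = s (p + k)
               & exists2 i, ncode i \in vals X & p' <= i < p' + l].
Proof.
have memE Y i x : (forall j, 14 < j -> Y j = X j) -> Y i = x ->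
    holds Y (FMem i) <-> x \in vals X.
  move=> HY <-; rewrite /vals /mkseq /=; split=> [/hasP[j jc /eqP E]|/mapP[j jc E]].
    by apply/mapP; exists j; rewrite // -HY; lia.
  by apply/hasP; exists j; rewrite // E HY //; lia.
move=> X0 X1 X2; split=> [[Y [HY _]]|[p' [pl Hs [i ivs /andP[pi ipl]]]]].
  have Y0 : Y 0 = ncode n by rewrite HY.
  have Y1 : Y 1 = ncode p by rewrite HY.
  have Y2 : Y 2 = ncode l by rewrite HY.
  have Y15 j : 14 < j -> Y j = X j by move=> j14; apply: HY; rewrite /inJ;
    clear -j14; lia.
  case=> h1; case=> h2; case=> hm; case=> h3; case=> h4; case=> h5 h6.
  have [p' [? [Y5 _ Y6]]] := (holds_add _ _ _ _).1 h1.
  have [? [r' [_ Y7 _]]] := (holds_add _ _ _ _).1 h2.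
  have [? [u [_ Y9 Y8]]] := (holds_add _ _ _ _).1 h3.
  have [? [w [_ Y10 _]]] := (holds_add _ _ _ _).1 h4.
  have e1 := (holds_addv Y5 Y2 Y6).1 h1.
  have e2 := (holds_addv Y6 Y7 Y0).1 h2.
  have e3 := (holds_addv Y5 Y9 Y8).1 h3.
  have e4 := (holds_addv Y8 Y10 Y6).1 h4.
  have w0 : w != 0.
    by apply/eqP => w0; apply: h5; apply/(holds_addv Y10 Y10 Y10); rewrite w0.
  exists p'; split; first by clear -e1 e2; lia.
    move=> k kl; apply: contrapT => ne; apply: h6; apply/(differP Y1 Y2 Y5).
    by exists k.
  by eexists; [apply/(memE Y 8 _ Y15 Y8)|clear -e1 e3 e4 w0; lia].
pose Y := setv X 5 [:: ncode p'; ncode (p' + l); ncode (n - (p' + l)); ncode i;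
  ncode (i - p'); ncode (p' + l - i)].
exists Y; split=> //; first by move=> j; apply: setv_out; rewrite /V //=; lia.
have Y0 : Y 0 = ncode n by rewrite -X0.
have Y1 : Y 1 = ncode p by rewrite -X1.
have Y2 : Y 2 = ncode l by rewrite -X2.
have Y15 j : 14 < j -> Y j = X j by move=> j14; apply: (@setv_out X 5 11) => //;
  rewrite /V /inJ; clear -j14; lia.
split; first by apply/(@holds_addv Y 5 2 6 p' l (p' + l)).
split; first by apply/(@holds_addv Y 6 7 0 (p' + l) (n - (p' + l)) n) => //; lia.
split; first by apply/(memE Y 8 (ncode i) Y15).
split; first by apply/(@holds_addv Y 5 9 8 p' (i - p') i) => //; lia.
split; first by apply/(@holds_addv Y 8 10 6 i (p' + l - i) (p' + l)) => //; lia.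
split.
  by move=> /(@holds_addv Y 10 10 10 (p' + l - i) (p' + l - i) (p' + l - i) erefl erefl erefl); lia.
by move=> /(differP Y1 Y2 (erefl : Y 5 = ncode p')) [k kl]; rewrite Hs.
Qed.

Lemma attrP X n : X 0 = ncode n -> holds X fAttr <-> attr n (vals X).
Proof.
have valsE Y : (forall j, 14 < j -> Y j = X j) -> vals Y = vals X.
  by move=> HY; apply: eq_mkseq => j; rewrite HY //; lia.
move=> X0; split=> [H p l l0 pl|H [Y [HY _]]].
  apply: contrapT => nocc; apply: H.
  pose Y := setv X 1 [:: ncode p; ncode l; ncode (p + l); ncode (n - (p + l))].
  exists Y; split=> //; first by move=> j; apply: setv_out; rewrite /V //=; lia.
  have Y0 : Y 0 = ncode n by rewrite -X0.
  have Y15 j : 14 < j -> Y j = X j by move=> j14; apply: (@setv_out X 1 5) => //;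
    rewrite /V /inJ; clear -j14; lia.
  split; first by apply/(@holds_addv Y 1 2 3 p l (p + l)).
  split; first by apply/(@holds_addv Y 3 4 0 (p + l) (n - (p + l)) n) => //; lia.
  split; first by move=> /(@holds_addv Y 2 2 2 l l l erefl erefl erefl); lia.
  move=> /(@occP Y n p l Y0 erefl erefl); by rewrite (valsE _ Y15).
have Y0 : Y 0 = ncode n by rewrite HY.
have Y15 j : 14 < j -> Y j = X j by move=> j14; apply: HY; rewrite /inJ; clear -j14;
  lia.
case=> h1; case=> h2; case=> h3 h4.
have [p [l [Y1 Y2 Y3]]] := (holds_add _ _ _ _).1 h1.
have [? [r [_ Y4 _]]] := (holds_add _ _ _ _).1 h2.
have e2 := (holds_addv Y3 Y4 Y0).1 h2.
apply: h4; apply/(occP Y0 Y1 Y2); rewrite (valsE _ Y15); apply: H; last by lia.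
by rewrite lt0n; apply/eqP => l0; apply: h3; apply/(holds_addv Y2 Y2 Y2); rewrite l0.
Qed.

Lemma vals_setv X vs : size vs = c -> vals (setv X 15 vs) = vs.
Proof.
move=> sz; rewrite -[RHS](@mkseq_nth _ 0 vs) sz; apply: eq_in_mkseq => j jc.
by rewrite /setv leq_addl addnC ltn_add2l sz jc addKn.
Qed.

Lemma ex_psP X n fl : X 0 = ncode n ->
  holds X (FEx fl 15 0 fAttr) <-> exists vs, [/\ size vs = c, attr n vs
    & fl -> size (undup vs) < size (undup (vals X))].
Proof.
move=> X0; split=> [[Y [HY Hc Ha]]|[vs [sz Ha Hc]]].
  exists (vals Y); rewrite size_mkseq -!card_psE; split=> //.
  by apply/(attrP (X := Y)) => //; rewrite HY.
exists (setv X 15 vs); split.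
- move=> i; rewrite /setv /inJ sz addnC -/V andbT; by case: ifP => // ->.
- by rewrite !card_psE -/(vals _) vals_setv // -/(vals X).
- by apply/(@attrP _ n) => //; rewrite vals_setv.
Qed.

Definition minimal n vs :=
  attr n vs /\ forall vs', size vs' = c -> attr n vs' ->
    size (undup vs) <= size (undup vs').

Lemma minP X n : X 0 = ncode n -> holds X fMin <-> minimal n (vals X).
Proof.
move=> X0; split=> -[/(attrP X0) Ha H]; split=> //.
  move=> vs' sz Ha'; rewrite leqNgt; apply/negP => lt; apply: H.
  by apply/(ex_psP true X0); exists vs'.
by move=> /(ex_psP true X0) [vs' [sz Ha' /(_ isT)]]; rewrite ltnNge H.
Qed.

End Semantics.

(** * A finite automaton from a right congruence *)

(** The Myhill-Nerode construction, with the values of [T] as states. *)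
Lemma dfao_of_congruence (F : finType) (T : seq nat -> F) K (g : F -> bool) :
  (forall w w' a, T w = T w' -> T (rcons w a) = T (rcons w' a)) ->
  exists2 M, d_out M != [::] &
    forall w, all (fun a => a < K) w -> dfa_accepts M w = g (T w).
Proof.
move=> cong.
(* [T] need not be onto; outside its image the transition is chosen arbitrarily. *)
have [delta Hd] : {delta : F * nat -> F &
    forall p w, T w = p.1 -> T (rcons w p.2) = delta p}.
  apply: (@choice _ _ (fun p y => forall w, T w = p.1 -> T (rcons w p.2) = y)).
  move=> [f a] /=.
  have [[w E]|H] := pselect (exists w, T w = f).
    by exists (T (rcons w a)) => w' E'; apply: cong; rewrite E E'.
  by exists f => w E; case: H; exists w.
pose val_of q := nth (T [::]) (enum F) q.
pose tr n := nat_of_ord (enum_rank (delta (val_of (n %/ K), n %% K))).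
pose M := DFAO K (enum_rank (T [::])) (mkseq tr (#|F| * K))
  (mkseq (fun q => nat_of_bool (g (val_of q))) #|F|).
have rankK f : val_of (enum_rank f) = f by rewrite /val_of nth_enum_rank.
have stE w : all (fun a => a < K) w -> dfao_state M w = enum_rank (T w).
  elim/last_ind: w => [|w a IH] //; rewrite all_rcons => /andP[aK Hw].
  rewrite /dfao_state -cats1 foldl_cat /= -/(dfao_state M w) cats1 IH //.
  have rF := ltn_ord (enum_rank (T w)).
  rewrite nth_mkseq; last first.
    apply: (@leq_trans ((enum_rank (T w)).+1 * K)); last by rewrite leq_mul2r rF orbT.
    by rewrite mulSn addnC ltn_add2r.
  rewrite /tr divnMDl ?modnMDl ?divn_small ?modn_small ?addn0 //; last by lia.
  by rewrite rankK -(Hd (T w, a) w).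
have F0 : 0 < #|F| by apply/card_gt0P; exists (T [::]).
exists M; first by rewrite -size_eq0 size_mkseq -lt0n.
move=> w Hw; rewrite /dfa_accepts /dfao_output stE // nth_mkseq // rankK.
by rewrite eqb0 negbK.
Qed.

Lemma sum_digits_lt b k (d : nat -> nat) : (forall j, j < k -> d j < b) ->
  \sum_(j < k) d j * b ^ j < b ^ k.
Proof.
elim: k => [|k IH] H; first by rewrite big_ord0.
rewrite big_ord_recr /= expnS.
have h1 : \sum_(j < k) d j * b ^ j < b ^ k by apply: IH => j ?; apply: H; lia.
apply: (@leq_trans ((d k).+1 * b ^ k)); first by rewrite mulSn ltn_add2r.
by rewrite leq_mul2r H ?orbT.
Qed.

Lemma sum_digits_inj b k (d d' : nat -> nat) :
  (forall j, j < k -> d j < b) -> (forall j, j < k -> d' j < b) ->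
  \sum_(j < k) d j * b ^ j = \sum_(j < k) d' j * b ^ j ->
  forall j, j < k -> d j = d' j.
Proof.
elim: k => [|k IH] H H' //; rewrite !big_ord_recr /= => E.
have Hk j : j < k -> d j < b by move=> ?; apply: H; lia.
have Hk' j : j < k -> d' j < b by move=> ?; apply: H'; lia.
have lt := sum_digits_lt Hk; have lt' := sum_digits_lt Hk'.
have dk : d k = d' k.
  have := congr1 (divn^~ (b ^ k)) E.
  rewrite /= ![_ + _ * b ^ k]addnC !divnMDl ?divn_small ?addn0 //; lia.
move=> j; rewrite ltnS leq_eqVlt => /orP[/eqP -> //|]; apply: IH => //.
by move: E; rewrite dk => /addIn.
Qed.

(** * Attractors as tuples of coded positions *)

Section Automaton.
Variables (b c : nat) (L A S B : dfao) (rep : nat -> seq nat).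
Hypothesis reg : regular_numeration b rep L A.
Let V := c + 15.
Let s := auto_seq S rep.
Let b1 : 1 < b := base_gt1 reg.
Local Notation ncode := (ncode b rep).
Local Notation vals := (vals c).
Local Notation attr := (attr b S rep).
Local Notation minimal := (minimal b c S rep).

Lemma nth_pad_lt l w t : all (fun a => a < b) w -> nth 0 (pad l w) t < b.
Proof.
move=> Hw; have [lt|ge] := ltnP t (size (pad l w)); last first.
  by rewrite nth_default // ltnW.
have /allP H : all (fun a => a < b) (pad l w).
  by rewrite all_cat Hw andbT all_nseq (ltnW b1) orbT.
by apply: H; apply: mem_nth.
Qed.

Lemma all_twords k x : all (fun a => a < b ^ k) (twords b k x).
Proof.
rewrite /twords tuple_word_mkseq; apply/allP => a /mapP[t _ ->].
by apply: (@sum_digits_lt b k (fun j => nth 0 (pad _ (word b (x j))) t)) => j _;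
  apply: nth_pad_lt; apply: all_word.
Qed.

(** Equal tuple words have equal length, so the tracks agree after padding to a common length; for
    representations this determines the number by [rep_pad_inj]. *)
Lemma twords_inj k x x' :
  (forall j, j < k -> repb b L (x j)) -> (forall j, j < k -> repb b L (x' j)) ->
  twords b k x = twords b k x' -> forall j, j < k -> x j = x' j.
Proof.
move=> Hx Hx'; rewrite /twords !tuple_word_mkseq /=.
set l := \max_(j < k) _; set l' := \max_(j < k) _ => E j jk.
have ll' : l = l' by have := congr1 size E; rewrite !size_mkseq.
have xl : size (word b (x j)) <= l by rewrite (leq_bigmax (Ordinal jk)).
have xl' : size (word b (x' j)) <= l.
  by rewrite ll' (leq_bigmax (Ordinal jk) (F := fun j : 'I_k => size (word b (x' j)))).
have Ep : pad l (word b (x j)) = pad l (word b (x' j)).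
  apply: (@eq_from_nth _ 0) => [|t]; rewrite !size_pad // => tl.
  have := congr1 (nth 0 ^~ t) E; rewrite /= -ll' !nth_mkseq //.
  move=> Et; apply: (@sum_digits_inj b k (fun j => nth 0 (pad l (word b (x j))) t)
    (fun j => nth 0 (pad l (word b (x' j))) t) _ _ Et) => // i _;
    by apply: nth_pad_lt; apply: all_word.
have /(repbP reg) [n xn] := Hx j jk; have /(repbP reg) [n' xn'] := Hx' j jk.
rewrite xn xn' !(word_ncode reg) in Ep xl xl' *.
by rewrite (rep_pad_inj reg xl xl' Ep).
Qed.

Lemma attr_of_set n (S0 : {set 'I_n}) vs :
  (forall i : 'I_n, i \in S0 -> ncode i \in vs) -> is_string_attractor s S0 ->
  attr n vs.
Proof.
move=> H HS p l l0 pl; have [p' [h1 h2 [i iS h3]]] := HS p l l0 pl.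
by exists p'; split=> //; exists (val i) => //; apply: H.
Qed.

(** Codes of positions outside the prefix do no harm: a position meeting an occurrence inside the
    prefix is below [n]. *)
Lemma set_of_attr n vs :
  attr n vs -> is_string_attractor s [set i : 'I_n | ncode i \in vs].
Proof.
move=> H p l l0 pl; have [p' [h1 h2 [i iS h3]]] := H p l l0 pl.
exists p'; split=> //; have iN : i < n by move: h3 h1; clear; lia.
by exists (Ordinal iN); rewrite ?inE.
Qed.

Lemma card_val_set n (S0 : {set 'I_n}) :
  size [seq ncode (val i) | i <- enum S0] = #|S0| /\
  uniq [seq ncode (val i) | i <- enum S0].
Proof.
rewrite size_map -cardE map_inj_uniq ?enum_uniq //.
by move=> i j /(ncode_inj reg) /val_inj.
Qed.

(** A smaller set is filled up to length [c] by repeating one element. For [n > 0] an attractor is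
    nonempty and this adds no new value; for [n = 0] the filling is the default 0, hence the
    restriction on the count. *)
Lemma tuple_of_set n (S0 : {set 'I_n}) : is_string_attractor s S0 ->
  #|S0| <= c -> exists vs, [/\ size vs = c, attr n vs
    & 0 < n -> size (undup vs) = #|S0|].
Proof.
move=> HS Sc; set t := [seq ncode (val i) | i <- enum S0].
have [szt ut] := card_val_set S0; rewrite -/t in szt ut.
exists (t ++ nseq (c - size t) (head 0 t)); split.
- by rewrite size_cat size_nseq subnKC // szt.
- apply: attr_of_set HS => i iS; rewrite mem_cat; apply/orP; left.
  by apply/mapP; exists i; rewrite ?mem_enum.
move=> n0; rewrite -szt; apply/perm_size/uniq_perm; rewrite ?undup_uniq // => x.
rewrite mem_undup mem_cat mem_nseq; case: (boolP (x \in t)) => //= xt.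
have t0 : t != [::].
  have [p' [_ _ [i iS _]]] := HS 0 1 isT n0.
  by rewrite -size_eq0 szt -lt0n; apply/card_gt0P; exists i.
apply: contraNF xt => /andP[_ /eqP ->].
by case: (t) t0 => //= *; rewrite mem_head.
Qed.

Lemma card_set_vals n vs :
  #|[set i : 'I_n | ncode i \in vs]| <= size (undup vs).
Proof.
have [<- u] := card_val_set [set i : 'I_n | ncode i \in vs].
apply: uniq_leq_size => // x /mapP[i]; rewrite mem_enum inE => h ->.
by rewrite mem_undup.
Qed.

Lemma holds_fAll X : holds b c L A S B X fAll <-> prefixes_have_attractor_of_size s c.
Proof.
split=> [H n|H [Y [HY _]]].
  apply: contrapT => noS; apply: H.
  pose Y := setv X 0 [:: ncode n].
  exists Y; split=> //.
    by move=> i; apply: setv_out; rewrite ?leq_addl // /V addnC.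
  split; first by apply/(repbP reg); exists n.
  move=> /(ex_psP c S B reg false (erefl : Y 0 = ncode n)) [vs [sz Ha _]].
  apply: noS; exists [set i : 'I_n | ncode i \in vs]; split; first exact: set_of_attr.
  by apply: leq_trans (card_set_vals n vs) _; rewrite -sz size_undup.
case=> /(repbP reg) [n Y0]; apply; apply/(ex_psP c S B reg false Y0).
have [S0 [HS Sc]] := H n; have [vs [sz Ha _]] := tuple_of_set HS Sc.
by exists vs.
Qed.

Lemma minimal_exists n : (exists S0 : {set 'I_n}, is_string_attractor s S0 /\ #|S0| <= c) ->
  exists vs, size vs = c /\ minimal n vs.
Proof.
move=> [S0 [HS Sc]].
pose P k := `[< exists vs, [/\ size vs = c, attr n vs & size (undup vs) = k] >].
have exP : exists k, P k.
  have [vs [sz Ha _]] := tuple_of_set HS Sc.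
  by exists (size (undup vs)); apply/asboolP; exists vs.
have [k /asboolP [vs [sz Ha kE]] Hmin] := ex_minnP exP.
exists vs; split=> //; split=> // vs' sz' Ha'; rewrite kE; apply: Hmin.
by apply/asboolP; exists vs'.
Qed.

(* Codes in a minimal tuple that denote no position below [n] could be
   dropped, so by minimality there are none. *)
Lemma minimal_spec n vs : 0 < n -> size vs = c -> minimal n vs ->
  exists ps, [/\ size ps = c, vs = map ncode ps, all (fun i => i < n) ps
    & is_minimum_attractor s [set i : 'I_n | val i \in ps]].
Proof.
move=> n0 sz [Ha Hmin]; set S0 := [set i : 'I_n | ncode i \in vs].
have HS := set_of_attr Ha; rewrite -/S0 in HS.
have cS : #|S0| <= c.
  by apply: leq_trans (card_set_vals n vs) _; rewrite -sz size_undup.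
have le : size (undup vs) <= #|S0|.
  have [vs' [sz' Ha' E]] := tuple_of_set HS cS.
  by rewrite -E //; apply: Hmin.
have [szt ut] := card_val_set S0.
have sub : {subset [seq ncode (val i) | i <- enum S0] <= undup vs}.
  by move=> x /mapP[i]; rewrite mem_enum inE => h ->; rewrite mem_undup.
have mE : [seq ncode (val i) | i <- enum S0] =i undup vs.
  by apply: (uniq_min_size ut sub _).2; rewrite szt.
have vsP x : x \in vs -> exists i : 'I_n, x = ncode i.
  rewrite -mem_undup -mE => /mapP[i _ ->]; by exists i.
have [f Hf] : {f : nat -> nat & forall x, x \in vs -> x = ncode (f x) /\ f x < n}.
  apply: (@choice _ _ (fun x y => x \in vs -> x = ncode y /\ y < n)) => x.
  have [/vsP [i ->]|nx] := boolP (x \in vs); last by exists 0.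
  by exists i => _; split.
exists (map f vs); rewrite size_map.
have vsE : vs = map ncode (map f vs).
  by rewrite -map_comp -[LHS]map_id; apply/eq_in_map => x /Hf [].
have SE : [set i : 'I_n | val i \in map f vs] = S0.
  apply/setP => i; rewrite !inE [in RHS]vsE mem_map //; exact: (ncode_inj reg).
split=> //; first by apply/allP => y /mapP[x /Hf [_ h] ->].
(* Attractors with more than [c] elements have no tuple to compare with, but they exceed [S0] in
   size anyway. *)
rewrite SE; split=> // S' HS'; have [S'c|cS'] := leqP #|S'| c; last first.
  exact: leq_trans cS (ltnW cS').
have [vs' [sz' Ha' <- //]] := tuple_of_set HS' S'c.
by apply: leq_trans (card_set_vals n vs) _; apply: Hmin.
Qed.

Lemma twords_rep X n ps : size ps = c -> X 0 = ncode n -> vals X = map ncode ps ->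
  twords b c.+1 (fun m => X (trk m)) = tuple_word b (map rep (n :: ps)).
Proof.
move=> sz X0 XE; rewrite /twords; congr tuple_word.
apply: (@eq_from_nth _ [::]); rewrite size_mkseq ?size_map /= ?sz // => j jc.
rewrite nth_mkseq //; case: j jc => [|j] jc /=; first by rewrite X0 (word_ncode reg).
rewrite (nth_map 0) ?sz // -(word_ncode reg); congr word.
have := congr1 (nth 0 ^~ j) XE; rewrite /= nth_mkseq // (nth_map 0) ?sz // => <-.
by rewrite /trk /= addSnnS.
Qed.

Lemma repall_vals X n ps : size ps = c -> X 0 = ncode n -> vals X = map ncode ps ->
  holds b c L A S B X FRepAll.
Proof.
move=> sz X0 XE; rewrite /holds; apply/allP => j.
rewrite mem_iota add0n => /andP[_ jc]; apply/(repbP reg).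
case: j jc => [|j] jc; first by exists n.
exists (nth 0 ps j); have := congr1 (nth 0 ^~ j) XE.
by rewrite /= nth_mkseq // (nth_map 0) ?sz // => <-; rewrite /trk /= addSnnS.
Qed.

(** The specification is limited to assignments vanishing from [V] on, as the checked formula speaks
    of variants of the zero assignment; a tuple of positions is turned into such an assignment. *)
Lemma provides_of_spec :
  (forall X, (forall i, V <= i -> X i = 0) -> holds b c L A S B X FRepAll ->
     holds b c L A S B X FAcc <-> holds b c L A S B X fMin) ->
  prefixes_have_attractor_of_size s c ->
  provides_min_attractors b rep s c B.
Proof.
move=> spec Hpre n n0.
have main ps : size ps = c ->
    dfa_accepts B (tuple_word b (map rep (n :: ps))) <-> minimal n (map ncode ps).
  move=> sz; pose X := setv (setv (fun _ => 0) 15 (map ncode ps)) 0 [:: ncode n].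
  have X0 : X 0 = ncode n by [].
  have XE : vals X = map ncode ps.
    rewrite -[RHS](@vals_setv c (fun _ => 0)) ?size_map //.
    by apply: eq_mkseq => j; rewrite /X /setv /= !addnS.
  have Xhigh i : V <= i -> X i = 0.
    move=> Vi; rewrite /X /setv /= size_map sz.
    by rewrite !ifF //; move: Vi; rewrite /V; clear; lia.
  have := spec X Xhigh (repall_vals sz X0 XE).
  by rewrite (minP c S B reg X0) XE /holds /racc /run (twords_rep sz X0 XE).
split.
  have [vs [sz Hmin]] := minimal_exists (Hpre n).
  have [ps [szp vE _ _]] := minimal_spec n0 sz Hmin.
  by exists ps; split=> //; apply/main => //; rewrite -vE.
move=> ps sz /(main _ sz) Hmin.
have [|ps' [_ vE Hlt Hm]] := minimal_spec n0 _ Hmin; first by rewrite size_map.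
by rewrite (inj_map (ncode_inj reg) vE).
Qed.

End Automaton.

(** * Existence of a suitable automaton *)

Fixpoint noacc f := match f with
  | FAcc => false
  | FNot f | FEx _ _ _ f => noacc f
  | FAnd f g => noacc f && noacc g
  | _ => true
  end.

(** Breaks a circularity: the colours are formed with a dummy automaton, and the real one is then
    built from them. *)
Lemma holds_noacc b c L A S B B' X f : noacc f ->
  holds b c L A S B X f -> holds b c L A S B' X f.
Proof.
elim: f B B' X => [i j k|i j|i|i|||f IH|f IHf g IHg|fl lo hi f IH] B B' X //.
- by move=> na nH H; apply: nH; apply: IH H.
- by move=> /andP[nf ng] [Hf Hg]; split; [apply: IHf Hf|apply: IHg Hg].
- by move=> na [Y [h1 h2 h3]]; exists Y; split=> //; apply: IH h3.
Qed.

Section Existence.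
Variables (b c : nat) (L A S : dfao) (rep : nat -> seq nat).
Hypothesis reg : regular_numeration b rep L A.
Let V := c + 15.
Let b1 : 1 < b := base_gt1 reg.

(* The tracks of a tuple word do not show where the shorter representations
   start, so the state collects the classes of all assignments compatible with
   the letters read so far. *)
Lemma automaton_exists : exists2 B, d_out B != [::] &
  forall X, holds b c L A S B X FRepAll ->
    holds b c L A S B X FAcc <-> holds b c L A S B X fMin.
Proof.
pose B0 := DFAO 0 0 [::] [::].
pose w := code_dfao L + code_dfao A + code_dfao S.
(* The level 4 is the quantifier depth of [fMin]. *)
have [|||Q [st [_ [ext sh] ref sat]]] :=
  @levels b c L A S B0 b1 w _ _ _ isT 4; try (apply: code_dfao_bounded; rewrite /w;
    lia).
pose k := c.+1; pose tr (X : nat -> nat) m := X (trk m).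
pose nz X := has (fun j => tr X j != 0) (iota 0 k).
pose T W := [set q | `[< exists X, [/\ st X = q, nz X & twords b k (tr X) = W] >]].
have TP W q : q \in T W -> exists X, [/\ st X = q, nz X & twords b k (tr X) = W].
  by rewrite inE => /asboolP.
have inT X : nz X -> st X \in T (twords b k (tr X)).
  by move=> h; rewrite inE; apply/asboolP; exists X.
have cong W W' a : T W = T W' -> T (rcons W a) = T (rcons W' a).
  suff sub U U' : T U = T U' -> T (rcons U a) \subset T (rcons U' a).
    by move=> E; apply/eqP; rewrite eqEsubset !sub.
  move=> E; apply/subsetP => q /TP [X [<- _ XW]].
  pose X1 i := X i %/ b; pose D i := X i %% b.
  have Db i : D i < b by rewrite ltn_mod; move: b1; clear; lia.
  have XE : X =1 (fun i => X1 i * b + D i) by move=> i; rewrite -divn_eq.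
  have := XW; rewrite (@eq_twords b k (tr X) (fun j => tr X1 j * b + tr D j));
    last first.
    by move=> j _; rewrite /tr XE.
  rewrite twords_shift //; last by move=> j; apply: Db.
  (* The word [rcons U a] is nonempty, so some track of [X1] has begun and [U] is the tuple word of
     the quotients. *)
  case: ifP => [nz1 /rcons_inj [UE aE]|_]; last by case: (U).
  have : st X1 \in T U' by rewrite -E -UE; apply: inT.
  move=> /TP [X2 [st2 nz2 W2]].
  have -> : st X = st (fun i => X2 i * b + D i).
    by rewrite (ext _ _ XE); apply: sh.
  have tE : twords b k (tr (fun i => X2 i * b + D i)) = rcons U' a.
    rewrite (@twords_shift b b1 k (tr X2) (tr D)); last by move=> j; apply: Db.
    rewrite -/(nz X2) nz2 W2 -aE; congr rcons; apply: eq_bigr => j _.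
    by rewrite /tr (same_zero (ref _ _ st2)) //; apply: trk_lt.
  rewrite -tE; apply: inT; have [j jk h] := hasP nz2; apply/hasP; exists j => //.
  by move: h b1; rewrite /tr; clear; case: (X2 _) => // n _; case: (b) => // m _;
    rewrite mulnSr addn_eq0; lia.
pose g (F : {set Q}) := `[< exists X, [/\ st X \in F,
  holds b c L A S B0 X FRepAll & holds b c L A S B0 X fMin] >].
have [B B_out HB] := @dfao_of_congruence _ T (b ^ k) g cong.
exists B => // X HX.
have -> : holds b c L A S B X FAcc = (g (T (twords b k (tr X))) : Prop).
  by rewrite -HB //; apply: all_twords reg _ _.
have HX' Y : holds b c L A S B Y FRepAll -> forall j, j < k -> repb b L (tr Y j).
  by move=> /allP H j jk; apply: H; rewrite mem_iota.
have /(repbP reg) [n X0] : repb b L (X 0) := HX' X HX 0 isT.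
split=> [/asboolP [X1 [/TP [X2 [st2 _ W2]] R1 M1]]|HM]; last first.
  apply/asboolP; exists X; split.
  - apply: inT; apply/hasP; exists 0 => //.
    by rewrite -[tr X 0]/(X 0) X0; apply: ncode_neq0 reg _.
  - exact: holds_noacc HX.
  - exact: holds_noacc HM.
have R2 := sat FRepAll isT isT _ _ (esym st2) R1.
have M2 : holds b c L A S B0 X2 fMin.
  by apply: sat (esym st2) M1 => //; rewrite /= /V; clear; lia.
(* [X2] and [X] share the tuple word, hence the prefix length and the positions; their other
   variables may differ, but minimality does not see them. *)
have E := twords_inj reg (HX' _ R2) (HX' _ HX) W2.
have X20 : X2 0 = ncode b rep n by rewrite -X0; apply: (E 0).
have VE : vals c X2 = vals c X.
  by apply: eq_in_mkseq => j jc; rewrite addnS -addSn; apply: (E j.+1).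
have M3 := (minP c S B0 reg X20).1 M2.
by apply/(minP c S B reg X0); rewrite -VE.
Qed.

End Existence.

(** * The two search procedures *)

Definition eTower := locked (fun w V =>
  Rec (eConst 5)
    (eMul (eExp (eMul (eExp (Suc w) (eConst 3)) (eConst 8)) (eExp V (eConst 3))) (Suc w))
    (eMul (Var 0) (eExp (eExp (eConst 2) (Var 0)) (eConst 256)))).

(** The 5 rounds are the quantifier depth of [fAll] and [fCheck]. *)
Lemma eval_tower env w V :
  eval env (eTower w V) = tower (eval env w) (eval env V) 5.
Proof.
have E x y d : iteri d (fun _ acc => acc * (2 ^ acc) ^ 256) (tower x y 0) =
    tower x y d by elim: d => // d IH; rewrite iteriS IH.
rewrite /eTower -lock eval_rec eval_const -E !evalE.
by apply: eq_iteri => i acc; rewrite !evalE.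
Qed.

(* Evaluated in the environment [:: z; x], with [x] the input. *)
Definition eCheck zB f :=
  Let zB (Let (eNth (Var 2) (eConst 4)) (Let (eNth (Var 3) (eConst 3))
  (Let (eNth (Var 4) (eConst 2)) (Let (eNth (Var 5) (eConst 1))
  (Let (eNth (Var 6) (eConst 0))
  (Let (eExp (Var 0) (eTower (eAdd (Var 6) (Var 7)) (eAdd (Var 1) (eConst 15))))
  (Let (Suc Zero) (Let Zero (fe f))))))))).

(** The automata in the input have codes at most [x] and the candidate is bounded by hypothesis, so
    [z + x] bounds all states and the tower computed from it is large enough. Evaluation starts from
    the zero assignment in base [b ^ 0]. *)
Lemma eval_check b c L A S B rep z zB f : regular_numeration b rep L A ->
  let x := code_input b L A S c in
  codes (eval [:: z; x] zB) B -> dfao_bounded B (z + x) ->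
  wf (c + 15) f -> depth f <= 5 ->
  eval [:: z; x] (eCheck zB f) != 0 <-> holds b c L A S B (dig (b ^ 0) 0) f.
Proof.
move=> reg x cB bB wff df; rewrite /eCheck !eval_let !eval_nth !eval_const !eval_var.
set e := eval [:: z; x] zB in cB *.
rewrite -[nth 0 _ 2]/x -[nth 0 _ 3]/x -[nth 0 _ 4]/x -[nth 0 _ 5]/x -[nth 0 _ 6]/x.
rewrite !nthc_code eval_exp eval_tower !eval_add eval_const !eval_var eval_suc eval_zero.
have bd M : code_dfao M \in [:: b; c; code_dfao L; code_dfao A; code_dfao S] ->
    dfao_bounded M (z + x).
  by move=> /mem_code_seq h; apply: code_dfao_bounded;
    apply: leq_trans h (leq_addl _ _).
have bdL : dfao_bounded L (z + x) by apply: bd; rewrite !inE eqxx !orbT.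
have bdA : dfao_bounded A (z + x) by apply: bd; rewrite !inE eqxx !orbT.
have bdS : dfao_bounded S (z + x) by apply: bd; rewrite !inE eqxx !orbT.
have a0 : 0 < (b ^ 0) ^ (c + 15) by rewrite expn0 exp1n.
exact: (fe_ok (base_gt1 reg) (codes_code_dfao L) (codes_code_dfao A)
  (codes_code_dfao S) cB bdL bdA bdS bB [:: z; x] wff df a0).
Qed.

Lemma checkP b c L A S B X : holds b c L A S B X fCheck <->
  forall Y, (forall i, c + 15 <= i -> Y i = X i) ->
    holds b c L A S B Y FRepAll ->
    holds b c L A S B Y FAcc <-> holds b c L A S B Y fMin.
Proof.
split=> [H Y HY HR|H [Y [HY _ [HR nH]]]]; last first.
  have [|h1 h2] := H Y _ HR.
    by move=> i ci; apply: HY; rewrite /inJ ltnNge ci.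
  by apply: nH; split=> -[a1 a2]; [apply: a2; apply: h1|apply: a1; apply: h2].
have agree i : ~~ inJ (c + 15) 0 0 i -> Y i = X i.
  by rewrite /inJ /= andbT -leqNgt; apply: HY.
apply: contrapT => nH; apply: H; exists Y; split=> //; split=> //.
by move=> [h1 h2]; apply: nH; split=> h; apply: contrapT => h';
  [apply: h1|apply: h2]; split.
Qed.

(** The search stops at the candidate equal to the truth value, so it always ends and its output 0
    or 1 is the answer. *)
Definition eDecide := eEq (Var 0) (eBool (eCheck Zero fAll)).
(** The first conjunct is [is_code], ensuring that the number found codes an automaton and not
    merely a list. *)
Definition eConstruct :=
  eAnd (eTls (eTls (Var 0) (eConst 3)) (eNth (Var 0) (eConst 2))) (eCheck (Var 0) fCheck).

Theorem theorem2 :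
  (exists p : seq instr,
     forall (b : nat) (L Add S : dfao) (c : nat) (rep : nat -> seq nat),
       regular_numeration b rep L Add ->
       exists y, cm_halts_with p (code_input b L Add S c) y /\
         ((prefixes_have_attractor_of_size (auto_seq S rep) c /\ y = 1) \/
          (~ prefixes_have_attractor_of_size (auto_seq S rep) c /\ y = 0)))
  /\
  (exists p : seq instr,
     forall (b : nat) (L Add S : dfao) (c : nat) (rep : nat -> seq nat),
       regular_numeration b rep L Add ->
       prefixes_have_attractor_of_size (auto_seq S rep) c ->
       exists B : dfao, cm_halts_with p (code_input b L Add S c) (code_dfao B) /\
         provides_min_attractors b rep (auto_seq S rep) c B).
Proof.
split; [exists (search eDecide)|exists (search eConstruct)];
    move=> b L A S c rep reg.
- set x := code_input b L A S c; set P := prefixes_have_attractor_of_size _ c.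
  have H z : eval [:: z; x] eDecide != 0 <-> z = `[< P >].
    rewrite /eDecide eval_eq eval_bool eval_var eqb0 negbK /=.
    have : eval [:: z; x] (eCheck Zero fAll) != 0 <-> P.
      apply: iff_trans (holds_fAll c S (DFAO 0 0 [::] [::]) reg (dig (b ^ 0) 0)).
      apply: eval_check reg _ _ _ _ => //; first exact: codes0.
      by rewrite /= /inJ; clear; lia.
    move=> /asbool_equiv_eq; rewrite asboolb => ->.
    by split=> /eqP.
  have [|z /H zE hz] := @search_ok eDecide x; first by exists `[< P >]; apply/H.
  exists z; split=> //; rewrite zE.
  by case: asboolP => p; [left|right].
move=> Hpre; set x := code_input b L A S c.
have evalC z : eval [:: z; x] eConstruct =
    is_code z && (eval [:: z; x] (eCheck (Var 0) fCheck) != 0).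
  by rewrite /eConstruct eval_and !eval_tls eval_nth !eval_const !eval_var.
have wfC : wf (c + 15) fCheck by rewrite /=; clear; lia.
have checkB B : eval [:: code_dfao B; x] (eCheck (Var 0) fCheck) != 0 <->
    holds b c L A S B (dig (b ^ 0) 0) fCheck.
  apply: eval_check reg _ _ _ _ => //; first exact: codes_code_dfao.
  by apply: code_dfao_bounded; apply: leq_addr.
(* The search ends because some automaton meets the specification. The one found may be another, but
   it has passed the same check. *)
have [|z] := @search_ok eConstruct x.
  have [B B_out HB] := automaton_exists c S reg.
  exists (code_dfao B); rewrite evalC code_dfao_is_code //= eqb0 negbK.
  by apply/checkB; apply/checkP => Y _; apply: HB.
rewrite evalC eqb0 negbK => /andP[/is_codeP [B ->] /checkB /checkP HB] hz.
exists B; split=> //; apply: (provides_of_spec reg) => // X HX; apply: HB => i ci.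
by rewrite HX // /dig div0n mod0n.
Qed.
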